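(* Let $d\ge 2$ be a natural number, $T_1,\dots,T_d>0$, and $[0,\mathbb{T}]_d:=[0,T_1]\times\dots\times[0,T_d]$. Let $W=(W(\underline{x}),\ \underline{x}\in\mathbb{R}_+^d)$ be a zero-mean continuous Gaussian random field for which there is a constant $\sigma>0$ such that $$\mathbb{E}(\exp(i\xi W(\underline{x})))=\exp\Big(-\tfrac12\sigma^2\xi^2(x_1+\dots+x_d)\Big)$$ for every $\xi\in\mathbb{R}$ and every $\underline{x}=(x_1,\dots,x_d)\in\mathbb{R}_+^d$. Let $l_k=(l_k(x),\ x\in[0,T_k])$, $k=1,\dots,d$, be independent Lévy subordinators with triplets $(\gamma_k,0,\nu_k)$, and assume that these processes are independent of $W$. Define the random field $$L:\Omega\times[0,\mathbb{T}]_d\to\mathbb{R},\qquad L(\underline{x}):=W(l_1(x_1),\dots,l_d(x_d)),\quad \underline{x}=(x_1,\dots,x_d)\in[0,\mathbb{T}]_d.$$ Then, for every $\underline{x}=(x_1,\dots,x_d)\in[0,\mathbb{T}]_d$ and every $\xi\in\mathbb{R}$, the characteristic function of $L(\underline{x})$ is $$\mathbb{E}(\exp(i\xi L(\underline{x})))=\exp\Big(-(x_1,\dots,x_d)\cdot\Big(\frac{\sigma^2\xi^2}{2}(\gamma_1,\dots,\gamma_d)^t+\int_{\mathbb{R}\setminus\{0\}}\big(1-e^{i\xi z}+i\xi z\,\mathbf{1}_{\{|z|\le1\}}(z)\big)\,\nu_{ext}(dz)\Big)\Big),$$ where $\nu_{ext}$ is the vector of measures $$\nu_{ext}([a,b]):=\big(\nu_1^\#([a,b]),\dots,\nu_d^\#([a,b])\big)^t,\qquad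 a,b\in\mathbb{R},$$ and, for $k=1,\dots,d$ and $a,b\in\mathbb{R}$, $$\nu_k^\#([a,b]):=\int_0^\infty\int_a^b\frac{1}{\sqrt{2\pi\sigma^2t}}\exp\Big(-\frac{x^2}{2\sigma^2t}\Big)\,dx\,\nu_k(dt).$$
   Context: $(\Omega,\mathcal{F},\mathbb{P})$ is a complete probability space and $\mathbb{R}_+:=[0,+\infty)$. A Gaussian random field (GRF) on $\mathbb{R}_+^d$ is a family of real random variables all of whose finite-dimensional marginals are multivariate Gaussian; ''continuous'' means that its paths are $\mathbb{P}$-almost surely continuous. $W$ is jointly measurable, i.e. $\mathcal{F}\otimes\mathcal{B}(\mathbb{R}_+^d)$-$\mathcal{B}(\mathbb{R})$-measurable. A Lévy process $l$ is a real-valued process with $l(0)=0$ a.s., independent and stationary increments, and stochastic continuity. A Lévy subordinator is a Lévy process that is $\mathbb{P}$-almost surely non-decreasing (so it takes values in $\mathbb{R}_+$). The triplet $(\gamma,0,\nu)$ of a subordinator $l$ refers to the representation $$\mathbb{E}(\exp(i\xi l(t)))=\exp\Big(t\Big(i\gamma\xi+\int_0^\infty (e^{i\xi y}-1)\,\nu(dy)\Big)\Big),\quad\xi\in\mathbb{R},$$ where $\nu$ is the Lévy measure of $l$, which satisfies $\nu(-\infty,0)=0$ and $\int_0^\infty\min(y,1)\,\nu(dy)<\infty$ (as a Lévy measure it puts no mass at $0$; integrals $\int_0^\infty$ against $\nu$ are over $(0,\infty)$). The integral against the vector of measures $\nu_{ext}$ is taken componentwise and ''$\cdot$'' is the Euclidean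 dot product. *)

(* Defs.v *)
(* MathComp / MathComp-Analysis *)
From HB Require Import structures.
From mathcomp Require Export all_boot all_order all_algebra complex.
From mathcomp Require Export all_classical all_reals all_analysis measurable_realfun.

Set Implicit Arguments.
Unset Strict Implicit.
Unset Printing Implicit Defensive.

Export Order.TTheory GRing.Theory Num.Theory.
Export numFieldNormedType.Exports.

Local Open Scope classical_set_scope.
Local Open Scope ring_scope.
Local Open Scope complex_scope.

Definition cexp {R : realType} (z : R[i]) : R[i] :=
  (expR (complex.Re z) * cos (complex.Im z)) +i*
  (expR (complex.Re z) * sin (complex.Im z)).

Definition cintegral d (T : measurableType d) (R : realType)
    (mu : {measure set T -> \bar R}) (D : set T) (f : T -> R[i]) : R[i] :=
  (\int[mu]_(x in D) complex.Re (f x)) +i* (\int[mu]_(x in D) complex.Im (f x)).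

Definition char_fun d (Omega : measurableType d) (R : realType)
    (P : probability Omega R) (X : Omega -> R) (xi : R) : R[i] :=
  cintegral P setT (fun w => cexp (0 +i* (xi * X w))).

Section Independence.
Context {d} {Omega : measurableType d} {R : realType}.
Variable P : probability Omega R.

Definition sigma_process (I : Type) (D : set I) (X : I -> Omega -> R)
    : set (set Omega) :=
  <<s [set A | exists2 t, D t &
         exists2 B : set R, measurable B & A = X t @^-1` B] >>.

Definition independent (G H : set (set Omega)) :=
  forall A B, G A -> H B -> P (A `&` B) = (P A * P B)%E.

Definition mutually_independent (I : finType) (G : I -> set (set Omega)) :=
  forall (J : {set I}) (A : I -> set Omega),
    (forall i, i \in J -> G i (A i)) ->
    P (\bigcap_(i in [set` J]) A i) = (\prod_(i in J) P (A i))%E.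

Definition same_law (X Y : Omega -> R) :=
  forall B : set R, measurable B -> P (X @^-1` B) = P (Y @^-1` B).

End Independence.

Section GaussianField.
Context {d} {Omega : measurableType d} {R : realType}.
Variable P : probability Omega R.

(* [normal_prob m s] has standard deviation [s] but is a junk value at [s = 0];
   a Gaussian law may be degenerate. *)
Definition gaussian_law (m s : R) (B : set R) : \bar R :=
  if s == 0 then \d_m B else normal_prob m s B.

Definition gaussian_rv (X : Omega -> R) :=
  measurable_fun setT X /\
  exists m s : R, 0 <= s /\
    forall B : set R, measurable B -> P (X @^-1` B) = gaussian_law m s B.

Definition multivariate_gaussian n (X : 'I_n -> Omega -> R) :=
  (forall i, measurable_fun setT (X i)) /\
  forall a : 'I_n -> R, gaussian_rv (fun w => \sum_(i < n) a i * X i w).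

Definition orthant n : set 'rV[R]_n := [set x | forall k, 0 <= x 0 k].

(* Random fields on the orthant are total functions of which only the values on
   [orthant n] are constrained. *)
Definition gaussian_field n (W : 'rV[R]_n -> Omega -> R) :=
  forall m (x : 'I_m -> 'rV[R]_n), (forall i, orthant (x i)) ->
    multivariate_gaussian (fun i => W (x i)).

Definition continuous_field n (W : 'rV[R]_n -> Omega -> R) :=
  {ae P, forall w, {within @orthant n, continuous (fun x => W x w)}}.

Definition jointly_measurable n (W : 'rV[R]_n -> Omega -> R) :=
  let borel_rV := g_sigma_algebraType (@open 'rV[R]_n) in
  measurable_fun ([set: Omega] `*` (@orthant n : set borel_rV))
    (fun p : Omega * borel_rV => W p.2 p.1).

Definition zero_mean n (W : 'rV[R]_n -> Omega -> R) :=
  forall x, orthant x -> 'E_P[W x]%E = 0%E.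

End GaussianField.

Section LevyProcess.
Context {d} {Omega : measurableType d} {R : realType}.
Variables (P : probability Omega R) (T : R) (l : R -> Omega -> R).

Definition independent_increments :=
  forall n (t : nat -> R),
    (forall i, (i <= n)%N -> t i \in `[0, T]) ->
    (forall i, (i < n)%N -> t i < t i.+1) ->
    mutually_independent P (fun k : 'I_n =>
      sigma_process [set: unit] (fun=> l (t k.+1) \- l (t k))).

Definition stationary_increments :=
  forall s t h, 0 <= h -> 0 <= s -> 0 <= t -> s + h <= T -> t + h <= T ->
    same_law P (l (s + h) \- l s) (l (t + h) \- l t).

Definition stochastically_continuous :=
  forall t e, t \in `[0, T] -> 0 < e ->
    P [set w | e < `|l s w - l t w|]
      @[s --> within `[0, T]%classic (nbhs t)] --> 0%E.

(* A process on [0, T] is a total function of which only the values on [0, T]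
   are constrained. *)
Definition levy_process :=
  [/\ forall t, t \in `[0, T] -> measurable_fun setT (l t),
      {ae P, forall w, l 0 w = 0},
      independent_increments,
      stationary_increments &
      stochastically_continuous].

Definition levy_subordinator :=
  levy_process /\
  {ae P, forall w, forall s t, 0 <= s -> s <= t -> t <= T -> l s w <= l t w}.

Definition subordinator_levy_measure (nu : {measure set R -> \bar R}) :=
  [/\ nu `]-oo, 0[%classic = 0%E, nu [set 0] = 0%E &
      (\int[nu]_(y in `]0%R, +oo[%classic) (Num.min y 1)%:E < +oo)%E].

Definition subordinator_triplet (gamma : R) (nu : {measure set R -> \bar R}) :=
  subordinator_levy_measure nu /\
  forall t xi, t \in `[0, T] ->
    char_fun P (l t) xi =
    cexp (t%:C * ((0 +i* (gamma * xi)) +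
      cintegral nu `]0, +oo[%classic (fun y => cexp (0 +i* (xi * y)) - 1))).

End LevyProcess.

Section NuSharp.
Context {R : realType}.
Variables (sigma : R) (nu : {measure set R -> \bar R}).

Definition heat_density (t x : R) : R :=
  (Num.sqrt (2 * pi * sigma ^+ 2 * t))^-1 *
  expR (- (x ^+ 2 / (2 * sigma ^+ 2 * t))).

(* The formula prescribed on intervals [a, b], extended to Borel sets. *)
Definition nu_sharp (A : set R) : \bar R :=
  (\int[nu]_(t in `]0%R, +oo[%classic)
     \int[lebesgue_measure]_(x in A) (heat_density t x)%:E)%E.

Let heat_density_ge0 t x : 0 <= heat_density t x.
Proof. by rewrite mulr_ge0 ?expR_ge0 ?invr_ge0 ?sqrtr_ge0. Qed.

Let measurable_inv d (T : measurableType d) (f : T -> R) :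
  measurable_fun setT f -> measurable_fun setT (fun x => (f x)^-1).
Proof.
move=> mf.
rewrite (_ : (fun x => _) = (fun x => f x * (`|f x| `^ (-1)) ^+ 2)); last first.
  apply/funext => x; rewrite powR_inv1// exprVn real_normK ?num_real//.
  have [->|fx0] := eqVneq (f x) 0; first by rewrite invr0 mul0r.
  by rewrite expr2 invfM mulrA divff// mul1r.
apply: measurable_funM => //; apply: measurable_funX.
apply: (@measurableT_comp _ _ _ _ _ _ (fun y : R => y `^ (-1)) _
  (fun x => `|f x|)); first exact: measurable_powR.
exact: measurableT_comp.
Qed.

Let measurable_heat_density :
  measurable_fun setT (fun p : R * R => heat_density p.1 p.2).
Proof.
apply: measurable_funM.
  apply: measurable_inv.
  apply: (@measurableT_comp _ _ _ _ _ _ (@Num.sqrt R)).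
    by apply: continuous_measurable_fun => x; exact: sqrt_continuous.
  by apply: measurable_funM.
apply: (@measurableT_comp _ _ _ _ _ _ (@expR R)) => //.
apply: (@measurableT_comp _ _ _ _ _ _ (@GRing.opp R)) => //.
apply: measurable_funM; first exact: measurable_funX.
by apply: measurable_inv; apply: measurable_funM.
Qed.

Let nu_sharp0 : nu_sharp set0 = 0%E.
Proof.
by rewrite /nu_sharp; apply: integral0_eq => t _; rewrite integral_set0.
Qed.

Let nu_sharp_ge0 A : (0 <= nu_sharp A)%E.
Proof.
by apply: integral_ge0 => t _; apply: integral_ge0 => x _; rewrite lee_fin.
Qed.

Let measurable_heat t : measurable_fun setT (fun x => (heat_density t x)%:E).
Proof.
apply/measurable_EFinP.
apply: (@measurableT_comp _ _ _ _ _ _ (fun p : R * R => heat_density p.1 p.2)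
  _ (pair t)); [exact: measurable_heat_density|exact: pair1_measurable].
Qed.

Let measurable_int_heat (A : set R) : measurable A ->
  measurable_fun setT
    (fun t => \int[lebesgue_measure]_(x in A) (heat_density t x)%:E)%E.
Proof.
move=> mA.
pose f (p : R * R) := (heat_density p.1 p.2 * \1_A p.2)%:E.
rewrite (_ : (fun t => _) = fubini_F lebesgue_measure f); last first.
  apply/funext => t; rewrite /fubini_F/= integral_mkcond.
  apply: eq_integral => x _; rewrite patchE /f/= indicE.
  by case: ifPn => _; rewrite ?mulr1 ?mulr0.
apply: (@measurable_fun_fubini_tonelli_F _ _ _ _ _ lebesgue_measure).
  apply/measurable_EFinP; apply: measurable_funM => //.
  apply: (@measurableT_comp _ _ _ _ _ _ (\1_A : R -> R) _ snd) => //.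
by move=> p; rewrite lee_fin mulr_ge0.
Qed.

Let nu_sharp_sigma_additive : semi_sigma_additive nu_sharp.
Proof.
move=> F mF tF mUF.
rewrite (_ : nu_sharp (\bigcup_n F n) = \sum_(0 <= n <oo) nu_sharp (F n))%E.
  exact: is_cvg_nneseries.
rewrite /nu_sharp -integral_nneseries//; last 2 first.
  by move=> n; apply: measurable_funTS; exact: measurable_int_heat.
  by move=> n t _; apply: integral_ge0 => x _; rewrite lee_fin.
apply: eq_integral => t _; apply: ge0_integral_bigcup => //.
  by apply: measurable_funTS; exact: measurable_heat.
by move=> x _; rewrite lee_fin.
Qed.

HB.instance Definition _ := isMeasure.Build _ _ _ nu_sharp
  nu_sharp0 nu_sharp_ge0 nu_sharp_sigma_additive.

End NuSharp.

(* [W] is evaluated at the random point (l_1(x_1), ..., l_d(x_d)); this may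
   leave the orthant only on a null event. *)
Definition subordinated_field (Omega : Type) (R : realType) n
    (W : 'rV[R]_n -> Omega -> R) (l : 'I_n -> R -> Omega -> R)
    (x : 'rV[R]_n) (w : Omega) : R :=
  W (\row_k l k (x 0 k) w) w.

(* Main.v *)
(** The Gaussian field enters only through [E exp (i xi W(t)) = exp (- a (t_1 + ... + t_d))] with
    [a = sigma^2 xi^2 / 2]. Discretizing the subordinators to finitely many values, independence
    and the continuity of [W] give [E exp (i xi L(x)) = prod_k E exp (- a l_k(x_k))], so the Laplace
    transform of each [l_k(x_k)] has to be deduced from its characteristic function.
    This is done without complex analysis: the measure [du / (1 + u^2)] on the positive half-line
    has cosine transform [C exp (- y)] for [y >= 0], so integrating [Re phi(a u)] against it turns
    characteristic functions of nonnegative variables into Laplace transforms at [a]. Applied to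
    [phi = exp (t (nu^ - nu^(0)))] with [nu] finite, it is multiplicative on the powers in
    [exp z = lim (1 + z / n)^n]; infinite [nu] are reached by truncation at [0].
    Finally [exp (- a t)] is the characteristic function at [xi] of the Gaussian density of
    variance [sigma^2 t], so [int (1 - exp (- a t)) nu(dt)] is the integral of [1 - cos (xi z)]
    against [nu_sharp]; the odd imaginary part vanishes because [nu_sharp] is symmetric. *)

Require Import Defs.
From mathcomp Require Import ring lra.

Local Open Scope classical_set_scope.
Local Open Scope ring_scope.
Local Open Scope complex_scope.

(** The characteristic function is given at real arguments, whereas [E exp (- a l)] is its value at
    an imaginary one; the usual bridge is analytic continuation. The kernel can replace it because
    [exp (- y)] is multiplicative in [y >= 0], as [exp (i y u)] is: kernel integration sends every
    polynomial in a characteristic function to the same polynomial in the Laplace transform, and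
    polynomials approximate the exponential. For all real [y] the cosine transform is
    [C exp (- |y|)], multiplicative only among frequencies of one sign; hence the insistence on
    nonnegative variables and shifts. Truncation is forced because the powers use [nu^] and the mass
    [nu^(0)] separately, while for infinite [nu] only the difference makes sense. The bound that
    controls the powers depends on the mass, so it does not survive the truncation limit; there
    [cos - 1 <= 0] takes over. On the Gaussian side, discretizing replaces the random point by
    deterministic nodes, so that only single values of [W] are tested against events of the
    subordinators. Completeness of [P] makes the limit of the discretized fields measurable. *)

Section Rintegral_extra.
Context {d} {T : measurableType d} {R : realType}.
Variable mu : {measure set T -> \bar R}.

Lemma cvg_Rintegral (D : set T) (f_ : nat -> T -> R) (f g : T -> R) :
  measurable D ->
  (forall n, measurable_fun D (f_ n)) -> measurable_fun D f ->
  {ae mu, forall x, D x -> f_ n x @[n --> \oo] --> f x} ->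
  mu.-integrable D (EFin \o g) ->
  (forall n x, D x -> `|f_ n x| <= g x) ->
  \int[mu]_(x in D) f_ n x @[n --> \oo] --> \int[mu]_(x in D) f x.
Proof.
move=> mD mf_ mf cf ig fg.
have [|||||intf _ h] := @dominated_convergence _ _ _ mu D mD
  (fun n x => (f_ n x)%:E) (fun x => (f x)%:E) (fun x => (g x)%:E).
- by move=> n; apply/measurable_EFinP.
- exact/measurable_EFinP.
- by apply: filterS cf => x + Dx => /(_ Dx) h; apply: cvg_EFin => //; exact: nearW.
- exact: ig.
- by apply: aeW => x n Dx; rewrite lee_fin fg.
rewrite /Rintegral; apply: fine_cvg.
by rewrite fineK//; exact: integrable_fin_num.
Qed.

Lemma integrableZl_EFin (D : set T) (r : R) (f : T -> R) : measurable D ->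
  mu.-integrable D (EFin \o f) -> mu.-integrable D (fun x => (r * f x)%:E).
Proof. by move=> mD fi; under eq_fun do rewrite EFinM; exact: integrableZl. Qed.

Lemma integrableB_EFin (D : set T) (f g : T -> R) : measurable D ->
  mu.-integrable D (EFin \o f) -> mu.-integrable D (EFin \o g) ->
  mu.-integrable D (fun x => (f x - g x)%:E).
Proof. by move=> mD fi gi; under eq_fun do rewrite EFinB; exact: integrableB. Qed.

Lemma integrableD_EFin (D : set T) (f g : T -> R) : measurable D ->
  mu.-integrable D (EFin \o f) -> mu.-integrable D (EFin \o g) ->
  mu.-integrable D (fun x => (f x + g x)%:E).
Proof. by move=> mD fi gi; under eq_fun do rewrite EFinD; exact: integrableD. Qed.

End Rintegral_extra.

(** * Real analysis preliminaries: scaling, elementary bounds, differentiation under the integral *)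

Section Lebesgue_scaling.
Context {R : realType}.
Notation mu := (@lebesgue_measure R).

(** Lebesgue measure equals [c] times its pushforward under [x -> c * x], since the two agree on
    half-open intervals. *)
Lemma lebesgue_integral_scale (c : R) (f : R -> R) : 0 < c ->
  measurable_fun setT f -> (forall x, 0 <= f x) ->
  (\int[mu]_x (f (c * x))%:E = (c^-1)%:E * \int[mu]_x (f x)%:E)%E.
Proof.
move=> c0 mf f0.
have mc : measurable_fun setT (fun x : R => c * x).
  exact: measurable_funM.
pose m := mscale (NngNum (ltW c0)) (pushforward mu (fun x : R => c * x : measurableTypeR R)).
have mE A : measurable A -> mu A = m mc A.
  move=> mA; apply: lebesgue_measure_unique => // _ [[a b]] _ <-.
  rewrite /m/= /mscale/= /pushforward.
  rewrite (_ : _ @^-1` _ = `]c^-1 * a, c^-1 * b]%classic); last first.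
    apply/seteqP; split => x /=; rewrite !in_itv/=.
      by rewrite ltr_pdivrMl// ler_pdivlMl.
    by rewrite ltr_pdivrMl// ler_pdivlMl.
  rewrite !lebesgue_measure_itv/= !lte_fin ltr_pM2l ?invr_gt0//.
  case: ifPn => _; last by rewrite mule0.
  by rewrite -EFinM; congr EFin; field; rewrite gt_eqF.
have -> : (\int[mu]_x (f x)%:E = \int[m mc]_x (f x)%:E)%E.
  by apply: eq_measure_integral => A mA _; exact: mE.
rewrite ge0_integral_mscale//=; last by move=> x _; rewrite lee_fin.
rewrite ge0_integral_pushforward//=; last by move=> x _; rewrite lee_fin.
by rewrite muleA -EFinM mulVf ?gt_eqF// mul1e.
all: exact/measurable_EFinP.
Qed.
End Lebesgue_scaling.

Section real_extra.
Context {R : realType}.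
Implicit Types (x y : R).

Lemma measurable_invr : measurable_fun [set: R] (@GRing.inv R).
Proof.
have -> : [set: R] = [set 0] `|` [set~ 0] by rewrite setUv.
apply/measurable_funU => //; first exact: measurableC.
split.
  exact: measurable_fun_set1.
apply: open_continuous_measurable_fun.
  rewrite openC; apply: accessible_closed_set1.
  exact/hausdorff_accessible/Rhausdorff.
by move=> x; rewrite inE/= => /eqP; exact: inv_continuous.
Qed.

Lemma measurable_cosMl y : measurable_fun setT (fun x => cos (y * x)).
Proof.
apply: continuous_measurable_fun => x.
apply: (@continuous_comp _ _ _ (fun x => y * x)); first exact: mulrl_continuous.
exact: continuous_cos.
Qed.

Lemma measurable_sinMl y : measurable_fun setT (fun x => sin (y * x)).
Proof.
apply: continuous_measurable_fun => x.
apply: (@continuous_comp _ _ _ (fun x => y * x)); first exact: mulrl_continuous.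
exact: continuous_sin.
Qed.

Lemma normr_sin_le x : `|sin x| <= `|x|.
Proof.
wlog x0 : x / 0 <= x => [h|].
  have [/h//|/ltW x0] := lerP 0 x.
  by rewrite -normrN -sinN -[leRHS]normrN h// oppr_ge0.
have [c _ h] := @MVT_segment R sin cos 0 x x0
  (fun y _ => is_derive_sin y) (continuous_subspaceT (@continuous_sin R)).
by move: h; rewrite sin0 !subr0 => ->; rewrite normrM ler_piMl// cos_max.
Qed.

Lemma onem_cos_le x : `|1 - cos x| <= x ^+ 2.
Proof.
have -> : 1 - cos x = 2 * sin (x / 2) ^+ 2.
  by rewrite [in LHS](splitr x) -mulr2n cos_mulr2n cos2sin2 !mulr2n; ring.
rewrite normrM normrX -[`|2|]/(`|2%:R|) normr_nat.
have /lerXn2r := normr_sin_le (x / 2).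
move=> /(_ 2%N); rewrite !nnegrE => /(_ (normr_ge0 _) (normr_ge0 _)) h.
have : `|x / 2| ^+ 2 = x ^+ 2 / 4 by rewrite -normrX ger0_norm ?sqr_ge0//; field.
have := sqr_ge0 x; lra.
Qed.

(** The differential equation of the kernel transform is only available for positive arguments, so
    constancy is needed on the open half-line. *)
Lemma is_derive0_cst_gt0 (f : R -> R) :
  (forall x, 0 < x -> is_derive x (1 : R) f 0) ->
  forall x y, 0 < x -> 0 < y -> f x = f y.
Proof.
move=> df; suff h x y : 0 < x -> x <= y -> f x = f y.
  move=> x y x0 y0; have [xy|/ltW yx] := lerP x y; first exact: h.
  exact/esym/h.
move=> x0 xy.
have p z : z \in `[x, y] -> 0 < z.
  by rewrite in_itv/= => /andP[xz _]; exact: lt_le_trans xz.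
have [||c _] := @MVT_segment R f (fun=> 0) x y xy.
- by move=> z zxy; apply: df; apply: p; exact: subset_itv_oo_cc zxy.
- apply: derivable_within_continuous => z zxy.
  by have := df _ (p _ zxy) => ?; exact: ex_derive.
by rewrite mul0r => /eqP; rewrite subr_eq0 eq_sym => /eqP.
Qed.

End real_extra.

Section derive_Rintegral.
Context {d} {T : measurableType d} {R : realType}.
Variable mu : {measure set T -> \bar R}.

(** The domination by [G] is local, on a window around [a]: for [J] below, the derivative of the
    integrand has a bound that grows with the parameter. *)
Lemma is_derive_Rintegral (f f' : R -> T -> R) (G : T -> R) (a r : R) :
  0 < r ->
  (forall x : R, x \in `]a - r, a + r[ -> mu.-integrable setT (EFin \o f x)) ->
  (forall (x : R) y, is_derive x (1 : R) (f ^~ y) (f' x y)) ->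
  mu.-integrable setT (EFin \o G) ->
  (forall x y, x \in `]a - r, a + r[ -> `|f' x y| <= G y) ->
  is_derive a (1 : R) (fun x => \int[mu]_y f x y) (\int[mu]_y f' a y).
Proof.
move=> r0 intf df intG fG.
have d1E (x : R) (y : T) : partial1of2 f x y = f' x y.
  by rewrite partial1of2E; have := df x y => ?; exact: derive_val.
have aI : `]a - r, a + r[%classic a.
  by rewrite /= in_itv/= ltrBlDr ltrDl r0.
have G0 y : 0 <= G y.
  by apply: le_trans (fG a y aI); exact: normr_ge0.
have dfx x y : `]a - r, a + r[%classic x -> [set: T] y -> derivable (f ^~ y) x 1.
  by move=> _ _; have := df x y => ?; exact: ex_derive.
have ub x y : `]a - r, a + r[%classic x -> [set: T] y -> `|partial1of2 f x y| <= G y.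
  by move=> xI _; rewrite d1E; exact: fG.
apply: DeriveDef.
  exact: (derivable_under_integral measurableT aI intf dfx G0 intG ub).
rewrite -derive1E (differentiation_under_integral measurableT aI intf dfx G0 intG ub).
by apply: eq_Rintegral => y _; exact: d1E.
Qed.

End derive_Rintegral.

(** * The cosine transform of the Cauchy kernel *)

Section cauchy_kernel.
Context {R : realType}.
Notation mu := (@lebesgue_measure R).

(** The Cauchy density up to a factor [pi], on half of the line. The open interval gives it the
    value 0 at 0, where the divisions by [u] below take the default value 0; otherwise [derJ1] would
    fail at [u = 0]. *)
Definition cauchy_kernel (u : R) : R := \1_(`]0, +oo[%classic) u / oneDsqr u.
Local Notation k := cauchy_kernel.

Let mden : measurable_fun [set: R] (fun u : R => (oneDsqr u)^-1).
Proof. by apply: continuous_measurable_fun; exact: continuous_oneDsqrV. Qed.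

Lemma cauchy_kernel_ge0 u : 0 <= k u.
Proof. by rewrite /k mulr_ge0// invr_ge0 (le_trans _ (oneDsqr_ge1 u)). Qed.

Lemma measurable_cauchy_kernel : measurable_fun setT k.
Proof.
apply: measurable_funM; first exact: measurable_indic.
exact: mden.
Qed.

Lemma integrable_cauchy_kernel : mu.-integrable setT (EFin \o k).
Proof.
apply/integrableP; split; first by apply/measurable_EFinP; exact: measurable_cauchy_kernel.
under eq_integral do rewrite /= ger0_norm ?cauchy_kernel_ge0//.
have -> : (\int[mu]_u (k u)%:E = \int[mu]_(u in `]0%R, +oo[) ((oneDsqr u)^-1)%:E)%E.
  rewrite [RHS]integral_mkcond; apply: eq_integral => u _.
  by rewrite patchE /k indicE; case: ifPn => _; rewrite ?mul1r ?mul0r.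
apply: (@le_lt_trans _ _ (pi / 2)%:E); last exact: ltry.
rewrite -integral0y_oneDsqr; apply: ge0_subset_integral => //=.
- apply/measurable_EFinP/measurable_funTS.
  exact: mden.
- by move=> u /=; rewrite !in_itv/= !andbT => /ltW.
Qed.

Lemma integrable_kernelM (h : R -> R) (M : R) : measurable_fun setT h ->
  (forall u, `|h u| <= M) -> mu.-integrable setT (fun u => (k u * h u)%:E).
Proof.
move=> mh hM.
have -> : (fun u => (k u * h u)%:E) = ((EFin \o k) \* (EFin \o h))%E by [].
apply: integrableMl => //; first exact: integrable_cauchy_kernel.
exists M; split; first exact: num_real.
by move=> x Mx u _ /=; exact: le_trans (hM u) (ltW Mx).
Qed.

(** The value is [pi / 2]. It can stay abstract: being positive, it cancels in
    [laplace_subordinator]. *)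
Definition cauchy_mass : R := \int[mu]_u k u.

Lemma cauchy_mass_gt0 : 0 < cauchy_mass.
Proof.
rewrite /cauchy_mass /Rintegral.
have -> : (\int[mu]_u (k u)%:E = \int[mu]_(u in `[0%R, +oo[) ((oneDsqr u)^-1)%:E)%E.
  rewrite -integral_itv_obnd_cbnd; last first.
    apply: measurable_funTS; by apply/measurable_EFinP; exact: mden.
  rewrite [RHS]integral_mkcond; apply: eq_integral => u _.
  by rewrite patchE /k indicE; case: ifPn => _; rewrite ?mul1r ?mul0r.
by rewrite integral0y_oneDsqr/= divr_gt0 ?pi_gt0.
Qed.

(** Differentiating [I] under the integral would produce [u sin (y u) / (1 + u ^+ 2)], which is not
    absolutely integrable. The integrand is instead integrated twice in [y]: [J0] and [J1] are
    successive antiderivatives of [J2], and the divisions by [u] keep all three dominated by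
    multiples of the kernel. *)
Local Notation I := (fun y => \int[mu]_u (k u * cos (y * u))).
Let J0 (y u : R) := k u * ((1 - cos (y * u)) / u ^+ 2).
Let J1 (y u : R) := k u * (sin (y * u) / u).
Let J2 (y u : R) := k u * cos (y * u).
Let J (y : R) := \int[mu]_u J0 y u.
Let J' (y : R) := \int[mu]_u J1 y u.

Let mcos (y : R) : measurable_fun setT (fun u : R => cos (y * u)).
Proof. exact: measurable_cosMl. Qed.

Let msin (y : R) : measurable_fun setT (fun u : R => sin (y * u)).
Proof. exact: measurable_sinMl. Qed.

Let mV : measurable_fun setT (fun u : R => u^-1).
Proof. exact: measurable_invr. Qed.

Let mVX : measurable_fun setT (fun u : R => (u ^+ 2)^-1).
Proof. by under eq_fun do rewrite -exprVn; exact: measurable_funX. Qed.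

Let k0 : k 0 = 0.
Proof. by rewrite /k indicE memNset ?mul0r//= in_itv/= ltxx. Qed.

Let J0_le (y u : R) : `|(1 - cos (y * u)) / u ^+ 2| <= y ^+ 2.
Proof.
have [->|u0] := eqVneq u 0; first by rewrite expr0n invr0 mulr0 normr0 sqr_ge0.
rewrite normrM [`|_^-1|]ger0_norm ?invr_ge0 ?sqr_ge0//.
rewrite ler_pdivrMr ?exprn_even_gt0//.
by rewrite (le_trans (onem_cos_le _))// exprMn.
Qed.

Let J1_le (y u : R) : `|sin (y * u) / u| <= `|y|.
Proof.
have [->|u0] := eqVneq u 0; first by rewrite invr0 mulr0 normr0.
rewrite normrM normfV ler_pdivrMr ?normr_gt0// -normrM.
exact: normr_sin_le.
Qed.

Let intJ0 (y : R) : mu.-integrable setT (EFin \o J0 y).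
Proof.
apply: (@integrable_kernelM _ (y ^+ 2)) => //.
by apply: measurable_funM => //; exact: measurable_funB.
Qed.

Let intJ1 (y : R) : mu.-integrable setT (EFin \o J1 y).
Proof. by apply: (@integrable_kernelM _ `|y|) => //; exact: measurable_funM. Qed.

Let intJ2 (y : R) : mu.-integrable setT (EFin \o J2 y).
Proof. by apply: (@integrable_kernelM _ 1) => // u; exact: cos_max. Qed.

Let derJ0 (y u : R) : is_derive y (1 : R) (J0^~ u) (J1 y u).
Proof.
rewrite /J0 /J1; have [->|u0] := eqVneq u 0.
  by rewrite k0 mul0r; under eq_fun do rewrite mul0r; exact: is_derive_cst.
apply: is_derive_eq.
rewrite /GRing.scale/=; field; exact: u0.
Qed.

Let derJ1 (y u : R) : is_derive y (1 : R) (J1^~ u) (J2 y u).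
Proof.
rewrite /J1 /J2; have [->|u0] := eqVneq u 0.
  by rewrite k0 mul0r; under eq_fun do rewrite mul0r; exact: is_derive_cst.
apply: is_derive_eq.
rewrite /GRing.scale/=; field; exact: u0.
Qed.

Let derJ (y : R) : is_derive y (1 : R) J (J' y).
Proof.
apply: (@is_derive_Rintegral _ _ _ mu J0 J1 (fun u => k u * (`|y| + 1)) y 1).
- exact: ltr01.
- by move=> x _; exact: intJ0.
- exact: derJ0.
- by apply: (@integrable_kernelM _ (`|y| + 1)) => // u; rewrite ger0_norm.
- move=> x u; rewrite in_itv/= -ltr_distl => xy.
  rewrite normrM ger0_norm ?cauchy_kernel_ge0// ler_wpM2l ?cauchy_kernel_ge0//.
  apply: le_trans (J1_le _ _) _.
  have := ler_distD 0 x y; rewrite subr0 sub0r normrN => h.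
  have := lerB_dist x y; lra.
Qed.

Let derJ' (y : R) : is_derive y (1 : R) J' (I y).
Proof.
apply: (@is_derive_Rintegral _ _ _ mu J1 J2 k y 1).
- exact: ltr01.
- by move=> x _; exact: intJ1.
- exact: derJ1.
- exact: integrable_cauchy_kernel.
- move=> x u _.
  by rewrite normrM ger0_norm ?cauchy_kernel_ge0// ler_piMr ?cauchy_kernel_ge0// cos_max.
Qed.

(** [K] enters as the slope of a linear term, which a second derivative annihilates, so its value is
    left unevaluated. *)
Let K0 (u : R) := \1_(`]0, +oo[%classic) u * ((1 - cos u) / u ^+ 2).
Let K := \int[mu]_u K0 u.

(* The sum of the two kernels is [1 / u ^+ 2], whose transform is linear in [y] by scaling. *)
Let JE (y : R) : 0 < y -> J y = K * y - cauchy_mass + I y.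
Proof.
move=> y0.
have -> : K * y = \int[mu]_u (y ^+ 2 * K0 (y * u)).
  have mK : measurable_fun setT K0.
    apply: measurable_funM; first exact: measurable_indic.
    apply: measurable_funM => //; apply: measurable_funB => //.
    exact: continuous_measurable_fun (@continuous_cos R).
  have K00 u : 0 <= K0 u.
    by rewrite mulr_ge0// mulr_ge0 ?invr_ge0 ?sqr_ge0// subr_ge0 cos_le1.
  rewrite /Rintegral.
  rewrite (lebesgue_integral_scale y (fun v => y ^+ 2 * K0 v) y0).
  - under [in RHS]eq_integral do rewrite EFinM.
    rewrite ge0_integralZl//; last 3 first.
    + exact/measurable_EFinP.
    + by move=> u _; rewrite lee_fin.
    + by rewrite lee_fin sqr_ge0.
    rewrite muleA -EFinM expr2 mulrA mulVf ?gt_eqF// mul1r /K /Rintegral.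
    (* An infinite integral would be sent to 0 by [fine] on both sides, as [y > 0]; the identity
       thus holds without a proof that [K0] is integrable. *)
    case: (integral _ _ _) => [r| |] /=; first by rewrite mulrC.
    + by rewrite gt0_muley//= mul0r.
    + by rewrite gt0_muleNy//= mul0r.
  - exact: measurable_funM.
  - by move=> u; rewrite mulr_ge0 ?sqr_ge0.
have -> : \int[mu]_u (y ^+ 2 * K0 (y * u)) =
    \int[mu]_u (J0 y u + (k u - J2 y u)).
  apply: eq_Rintegral => u _; rewrite /K0 /J0 /J2 /k.
  have -> : \1_(`]0, +oo[%classic) (y * u) = \1_(`]0, +oo[%classic) u :> R.
    rewrite !indicE; congr (nat_of_bool _)%:R.
    by apply/idP/idP; rewrite !inE/= !in_itv/= !andbT pmulr_rgt0.
  have [->|u0] := eqVneq u 0.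
    have -> : \1_(`]0, +oo[%classic) (0 : R) = 0 :> R.
      by rewrite indicE memNset//= in_itv/= ltxx.
    by rewrite !mul0r mulr0 subrr addr0.
  rewrite /oneDsqr; field; rewrite u0 (gt_eqF y0) andbT/=.
  by rewrite gt_eqF// ltr_pwDl// sqr_ge0.
rewrite RintegralD//; last first.
  rewrite /comp; under eq_fun do rewrite EFinB.
  by apply: integrableB => //; [exact: integrable_cauchy_kernel|exact: intJ2].
rewrite RintegralB//; last exact: integrable_cauchy_kernel.
by rewrite -/(J y) -/cauchy_mass /J2 /=; ring.
Qed.

Let I_bound (y : R) : `|I y| <= cauchy_mass.
Proof.
apply: le_trans (le_normr_Rintegral _ _) _ => //; first exact: intJ2.
apply: le_Rintegral => //.
- by have := integrable_abse (intJ2 y).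
- exact: integrable_cauchy_kernel.
- move=> u _.
  by rewrite normrM ger0_norm ?cauchy_kernel_ge0// ler_piMr ?cauchy_kernel_ge0// cos_max.
Qed.

Let J0E : J 0 = 0.
Proof.
rewrite /J (_ : J0 0 = cst 0) ?Rintegral_cst ?mul0r//.
by apply/funext => u; rewrite /J0 mul0r cos0 subrr mul0r mulr0.
Qed.

(* [I] equals [J y - K * y + cauchy_mass], whose second derivative is [I], so that on the
   positive half-line [I' + I] is a multiple of [expR]; boundedness excludes growth. *)
Lemma cauchy_transform (y : R) : 0 <= y ->
  \int[mu]_u (k u * cos (y * u)) = cauchy_mass * expR (- y).
Proof.
move=> y_ge0.
(* [H] agrees with [I] for positive arguments but is differentiable on the whole line, which
   provides its limit at 0. *)
pose H (y : R) := J y - K * y + cauchy_mass.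
have HI x : 0 < x -> I x = H x by move=> x0; rewrite /H JE//; ring.
have derH (x : R) : is_derive x (1 : R) H (J' x - K).
  have := derJ x => ?; apply: is_derive_eq.
  by rewrite /GRing.scale/=; ring.
have dS (x : R) : 0 < x -> is_derive x (1 : R) (fun x => (J' x - K + H x) * expR (- x)) 0.
  move=> x0; have := derJ' x => ?; have := derH x => ?; apply: is_derive_eq.
  by rewrite HI// /GRing.scale/=; ring.
have [C HC] : exists C, forall x, 0 < x -> J' x - K + H x = C * expR x.
  exists ((J' 1 - K + H 1) * expR (- 1)) => x x0.
  rewrite -(is_derive0_cst_gt0 _ dS x 1 x0 ltr01).
  by rewrite -mulrA -expRD addNr expR0 mulr1.
(* Since [H' = C * expR x - H], the derivative of [H * expR] is [C * expR (2 x)], whence the factor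
   [C / 2]. *)
have dE (x : R) : 0 < x ->
    is_derive x (1 : R) (fun x => H x * expR x - C / 2 * expR (x *+ 2)) 0.
  move=> x0; have := derH x => ?; apply: is_derive_eq.
  rewrite /GRing.scale/=.
  have -> : J' x - K = C * expR x - H x by rewrite -HC//; ring.
  by rewrite mulr2n expRD; field.
have [B HB] : exists B, forall x, 0 < x -> H x = C / 2 * expR x + B * expR (- x).
  exists (H 1 * expR 1 - C / 2 * expR (1 *+ 2)) => x x0.
  rewrite -(is_derive0_cst_gt0 _ dE x 1 x0 ltr01).
  rewrite mulr2n expRD expRN; field.
  by rewrite gt_eqF// expR_gt0.
have C0 : C = 0.
  apply: contrapT => /eqP C0.
  have C'0 : 0 < `|C| by rewrite normr_gt0.
  have B0 : 0 <= `|B| by exact: normr_ge0.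
  (* Chosen so that [|C| / 2 * x], a lower bound of the growing term, exceeds the bound
     [cauchy_mass + |B|] by 1. *)
  pose x := 2 * (cauchy_mass + `|B| + 1) / `|C|.
  have x0 : 0 < x.
    by rewrite /x divr_gt0// mulr_gt0//; have := cauchy_mass_gt0; lra.
  have := I_bound x; rewrite /= HI// HB// => h.
  have h1 : `|C / 2 * expR x| <= cauchy_mass + `|B|.
    have := ler_normB (C / 2 * expR x + B * expR (- x)) (B * expR (- x)).
    rewrite addrK => h2; apply: le_trans h2 _; apply: lerD => //.
    rewrite normrM [`|expR _|]ger0_norm ?expR_ge0// ler_piMr//.
    by rewrite -expR0 ler_expR; lra.
  move: h1; rewrite normrM normrM [`|expR _|]ger0_norm ?expR_ge0//.
  rewrite [`|2^-1|]ger0_norm//.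
  have : `|C| / 2 * x <= `|C| / 2 * expR x.
    apply: ler_wpM2l; first lra.
    by have := expR_ge1Dx x; move: (expR x) => e; lra.
  have -> : `|C| / 2 * x = cauchy_mass + `|B| + 1 by rewrite /x; field; rewrite gt_eqF.
  lra.
(* [H x * expR x] is the constant [B] for [x > 0], and its limit from the right at 0 is
   [H 0 = cauchy_mass]. *)
have cB : B = cauchy_mass.
  have H0 : H 0 * expR 0 = cauchy_mass.
    by rewrite /H J0E mulr0 subrr add0r expR0 mulr1.
  have cf : H x * expR x @[x --> 0^'+] --> H 0 * expR 0.
    apply: (@cvg_at_right_filter _ _ (fun x => H x * expR x)).
    have := derH 0 => ?.
    have dH : derivable (fun x : R => H x * expR x) 0 1 by exact: ex_derive.
    exact: (differentiable_continuous (iffLR (derivable1_diffP _ _) dH)).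
  rewrite -H0; apply: (@cvg_unique _ (@Rhausdorff R) (H x * expR x @[x --> 0^'+])) => //.
  apply: cvg_near_cst; near=> x.
  by rewrite HB// C0 !mul0r add0r -mulrA -expRD addNr expR0 mulr1.
have [->|y0] := eqVneq y 0.
  rewrite oppr0 expR0 mulr1; apply: eq_Rintegral => u _.
  by rewrite mul0r cos0 mulr1.
have {}y0 : 0 < y by rewrite lt_neqAle eq_sym y0.
by have := HI y y0; rewrite /= => ->; rewrite HB// C0 cB mul0r mul0r add0r.
Unshelve. all: by end_near. Qed.

End cauchy_kernel.

(** * The characteristic function of the Gaussian density *)

Section heat_density.
Context {R : realType}.
Notation mu := (@lebesgue_measure R).
Variables (sigma t : R).
Hypotheses (sigma0 : 0 < sigma) (t0 : 0 < t).
Local Notation h := (heat_density sigma t).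
Let v := sigma ^+ 2 * t.

Let v0 : 0 < v. Proof. by rewrite mulr_gt0// exprn_gt0. Qed.

Lemma heat_densityE z :
  h z = (Num.sqrt (2 * pi * v))^-1 * expR (- (z ^+ 2 / (2 * v))).
Proof. by rewrite /heat_density /v !mulrA. Qed.

Lemma heat_density_ge0 z : 0 <= h z.
Proof. by rewrite heat_densityE mulr_ge0 ?expR_ge0 ?invr_ge0 ?sqrtr_ge0. Qed.

Lemma heat_densityN z : h (- z) = h z.
Proof. by rewrite /heat_density sqrrN. Qed.

Lemma heat_density_normal_pdf : h = normal_pdf 0 (Num.sqrt v).
Proof.
apply/funext => z; rewrite normal_pdfE/= ?sqrtr_eq0 -?ltNge//.
rewrite heat_densityE /normal_peak /normal_fun subr0 sqr_sqrtr ?(ltW v0)//.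
congr (_^-1 * expR _); first by congr Num.sqrt; rewrite -mulr_natl; ring.
by rewrite -[v *+ 2]mulr_natl mulNr.
Qed.

Let sv0 : Num.sqrt v != 0.
Proof. by rewrite sqrtr_eq0 -ltNge. Qed.

Lemma continuous_heat_density : continuous h.
Proof. by rewrite heat_density_normal_pdf; exact: continuous_normal_pdf. Qed.

Lemma integral_heat_density : \int[mu]_z h z = 1.
Proof.
rewrite /Rintegral; under eq_integral do rewrite heat_density_normal_pdf.
by rewrite integral_normal_pdf.
Qed.

Lemma integrable_heat_density : mu.-integrable setT (EFin \o h).
Proof. by rewrite heat_density_normal_pdf; exact: integrable_normal_pdf. Qed.

Lemma is_derive_heat_density (z : R) :
  is_derive z (1 : R) h (- (z / v) * h z).
Proof.
rewrite (_ : h = fun z => (Num.sqrt (2 * pi * v))^-1 * expR (- (z ^+ 2 / (2 * v)))); last first.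
  by apply/funext => y; exact: heat_densityE.
apply: is_derive_eq.
rewrite /GRing.scale/=; move: (Num.sqrt (2 * pi * v))^-1 => c.
by field; rewrite gt_eqF.
Qed.

(** Half of the Gaussian exponent is spent on absorbing [z]: with [q = z ^+ 2 / (4 v)], one has [|z|
    <= 1 + z ^+ 2 = 1 + 4 v q <= (1 + 4 v) expR q]. What remains is the density of variance [2 v],
    up to the normalization [sqrt 2]. *)
Let id_heat_le z : `|z * h z| <=
  (1 + 4 * v) * Num.sqrt 2 * normal_pdf 0 (Num.sqrt (2 * v)) z.
Proof.
have vv0 : 0 < 2 * v by rewrite mulr_gt0.
rewrite normal_pdfE/= ?sqrtr_eq0 -?ltNge//.
rewrite heat_densityE /normal_peak /normal_fun subr0 sqr_sqrtr ?(ltW vv0)//.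
rewrite normrM [`|_^-1 * _|]ger0_norm ?mulr_ge0 ?expR_ge0 ?invr_ge0//.
have -> : 2 * v * pi *+ 2 = 2 * (2 * pi * v) by rewrite -mulr_natl; ring.
rewrite [Num.sqrt (2 * (2 * _ * _))]sqrtrM// [(_ * Num.sqrt (2 * pi * v))^-1]invfM.
set c := (Num.sqrt (2 * pi * v))^-1.
have c0 : 0 <= c by rewrite invr_ge0.
have -> : (1 + 4 * v) * Num.sqrt 2 * ((Num.sqrt 2)^-1 * c * expR (- z ^+ 2 / (2 * v *+ 2))) =
   c * ((1 + 4 * v) * expR (- z ^+ 2 / (2 * v *+ 2))).
  by field; rewrite sqrtr_eq0 -ltNge.
rewrite mulrCA ler_wpM2l//.
have -> : - (z ^+ 2 / (2 * v)) = - z ^+ 2 / (2 * v *+ 2) + - z ^+ 2 / (2 * v *+ 2).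
  by rewrite -mulr_natl; field; rewrite gt_eqF.
rewrite expRD mulrA ler_wpM2r ?expR_ge0//.
rewrite mulNr expRN ler_pdivrMr ?expR_gt0//.
have := expR_ge1Dx (z ^+ 2 / (2 * v *+ 2)).
move: (expR _) => e.
rewrite -mulr_natl; set q := _ / _ => he.
have zq : z ^+ 2 = 4 * v * q by rewrite /q; field; rewrite gt_eqF.
have z2 : `|z| <= 1 + z ^+ 2.
  rewrite -(real_normK (num_real z)); have := sqr_ge0 (`|z| - 1 / 2); rewrite sqrrB.
  move: (`|z|) => y; rewrite -mulr_natl; lra.
have q0 : 0 <= q by rewrite /q divr_ge0 ?sqr_ge0// mulr_ge0// ltW.
apply: (le_trans z2); rewrite zq.
have : (1 + 4 * v) * (1 + q) <= (1 + 4 * v) * e by rewrite ler_wpM2l//; have := v0; lra.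
have := v0; nra.
Qed.

Let mh : measurable_fun setT h.
Proof. exact: continuous_measurable_fun continuous_heat_density. Qed.

Let mcos y : measurable_fun setT (fun u : R => cos (y * u)).
Proof. exact: measurable_cosMl. Qed.

Let msin y : measurable_fun setT (fun u : R => sin (y * u)).
Proof. exact: measurable_sinMl. Qed.

Let int_id_heat : mu.-integrable setT (EFin \o (fun z => `|z * h z|)).
Proof.
apply: (@le_integrable _ _ _ mu _ measurableT _
   (fun z => ((1 + 4 * v) * Num.sqrt 2)%:E * (normal_pdf 0 (Num.sqrt (2 * v)) z)%:E)%E).
- apply/measurable_EFinP; apply: measurableT_comp => //; exact: measurable_funM.
- move=> z _; rewrite /= normr_id lee_fin.
  by rewrite (le_trans (id_heat_le z))// ler_norm.
- by apply: integrableZl => //; exact: integrable_normal_pdf.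
Qed.

Let int_cos (y : R) : mu.-integrable setT (EFin \o (fun z => cos (y * z) * h z)).
Proof.
apply: (@le_integrable _ _ _ mu _ measurableT _ (EFin \o h)).
- by apply/measurable_EFinP; apply: measurable_funM; [exact: mcos|exact: mh].
- by move=> z _; rewrite /= lee_fin normrM ler_piMl// cos_max.
- exact: integrable_heat_density.
Qed.

Let int_sin (y : R) : mu.-integrable setT (EFin \o (fun z => sin (y * z) * (z * h z))).
Proof.
apply: (@le_integrable _ _ _ mu _ measurableT _ (EFin \o (fun z => `|z * h z|))).
- apply/measurable_EFinP; apply: measurable_funM; first exact: msin.
  by apply: measurable_funM => //; exact: mh.
- by move=> z _; rewrite /= lee_fin normr_id normrM ler_piMl// sin_max.
- exact: int_id_heat.
Qed.

(** [G y] is the derivative of [F y], which vanishes at infinity. That its integral is 0 is the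
    integration by parts behind the differential equation of the characteristic function. *)
Let F y z := sin (y * z) * h z.
Let G y z := y * (cos (y * z) * h z) - v^-1 * (sin (y * z) * (z * h z)).

Let derF (y z : R) : is_derive z (1 : R) (F y) (G y z).
Proof.
have := is_derive_heat_density z => ?.
by rewrite /F /G; apply: is_derive_eq; rewrite /GRing.scale/=; ring.
Qed.

Let continuousG (y : R) : continuous (G y).
Proof.
have cc : continuous (fun z : R => y * z) by move=> z; exact: mulrl_continuous.
have ccos : continuous (fun z : R => cos (y * z)).
  by move=> z; apply: (@continuous_comp _ _ _ (fun u => y * u)); [exact: cc|exact: continuous_cos].
have csin : continuous (fun z : R => sin (y * z)).
  by move=> z; apply: (@continuous_comp _ _ _ (fun u => y * u)); [exact: cc|exact: continuous_sin].
move=> z; apply: cvgB; apply: cvgM; try exact: cvg_cst; apply: cvgM.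
- exact: ccos.
- exact: continuous_heat_density.
- exact: csin.
- by apply: cvgM; [exact: cvg_id|exact: continuous_heat_density].
Qed.

Let intG (y : R) : mu.-integrable setT (EFin \o G y).
Proof.
apply: (@integrableB_EFin _ _ _ mu setT) => //.
  exact: (integrableZl_EFin _ _ _ _ _ (int_cos y)).
exact: (integrableZl_EFin _ _ _ _ _ (int_sin y)).
Qed.

Let heat_le (n : nat) : h n.+1%:R <= (Num.sqrt (2 * pi * v))^-1 * (2 * v) * harmonic n.
Proof.
rewrite heat_densityE /harmonic/= -[leRHS]mulrA ler_wpM2l ?invr_ge0//.
have n1 : 1 <= n.+1%:R :> R by rewrite ler1n.
rewrite expRN -[2 * v / _]invf_div lef_pV2 ?posrE ?expR_gt0//; last first.
  by rewrite divr_gt0// ?mulr_gt0.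
have := expR_ge1Dx (n.+1%:R ^+ 2 / (2 * v)).
have : n.+1%:R / (2 * v) <= n.+1%:R ^+ 2 / (2 * v).
  apply: ler_wpM2r; first by rewrite invr_ge0 mulr_ge0 ?(ltW v0).
  by rewrite expr2 ler_peMl// (le_trans _ n1).
move: (expR _) => e; lra.
Qed.

Let cvg_heat : h n.+1%:R @[n --> \oo] --> 0.
Proof.
apply: (@squeeze_cvgr _ _ _ _ (cst 0)
  (fun n => (Num.sqrt (2 * pi * v))^-1 * (2 * v) * harmonic n)).
- by apply: nearW => n; rewrite heat_density_ge0 heat_le.
- exact: cvg_cst.
- rewrite -[X in _ --> X](mulr0 ((Num.sqrt (2 * pi * v))^-1 * (2 * v))).
  by apply: cvgMr; exact: cvg_harmonic.
Qed.

Let integralG (y : R) : \int[mu]_z G y z = 0.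
Proof.
(* The bounds [n.+1] keep the interval nondegenerate, as the fundamental theorem of calculus
   requires. *)
pose I n := `[- n.+1%:R, n.+1%:R : R]%classic.
have h1 : \int[mu]_z (G y z * \1_(I n) z) @[n --> \oo] --> \int[mu]_z G y z.
  apply: (@cvg_Rintegral _ _ _ mu setT _ _ (fun z => `|G y z|)) => //.
  - move=> n; apply: measurable_funM; first exact: continuous_measurable_fun (continuousG y).
    by apply: measurable_indic; exact: measurable_itv.
  - exact: continuous_measurable_fun (continuousG y).
  - apply: aeW => z _; apply: cvg_near_cst; near=> n.
    rewrite indicE mem_set ?mulr1// /I/= in_itv/= -ler_norml.
    apply: (@le_trans _ _ n%:R); last by rewrite ler_nat.
    by near: n; exact: nbhs_infty_ger.
  - by have := integrable_abse (intG y).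
  - move=> n z _; rewrite normrM ler_piMr// indicE.
    by case: (_ \in _); rewrite ?normr1 ?normr0.
have h2 : \int[mu]_z (G y z * \1_(I n) z) @[n --> \oo] --> (0 : R).
  have -> : (fun n => \int[mu]_z (G y z * \1_(I n) z)) =
      (fun n => (sin (y * n.+1%:R) *+ 2) * h n.+1%:R).
    apply/funext => n.
    have -> : \int[mu]_z (G y z * \1_(I n) z) = \int[mu]_(z in I n) G y z.
      rewrite [RHS]Rintegral_mkcond; apply: eq_Rintegral => z _.
      by rewrite patchE indicE; case: ifPn => _; rewrite ?mulr1 ?mulr0.
    have n0 : - n.+1%:R < n.+1%:R :> R by rewrite gtrN.
    rewrite /Rintegral (@continuous_FTC2 _ _ (F y) _ _ n0).
    - by rewrite /F/= mulrN sinN heat_densityN; ring.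
    - exact: continuous_subspaceT (continuousG y).
    - have cF : continuous (F y).
        move=> z; have := derF y z => ?.
        have dH : derivable (F y) z 1 by exact: ex_derive.
        exact: (differentiable_continuous (iffLR (derivable1_diffP _ _) dH)).
      split.
      + by move=> z _; have := derF y z => ?; exact: ex_derive.
      + by apply: cvg_at_right_filter; exact: cF.
      + by apply: cvg_at_left_filter; exact: cF.
    - by move=> z _; rewrite derive1E; have := derF y z => ?; exact: derive_val.
  apply: norm_cvg0; apply: (@squeeze_cvgr _ _ _ _ (cst 0) (fun n => 2 * h n.+1%:R)).
  - apply: nearW => n /=; rewrite normr_ge0/= normrM ler_pM//.
      by rewrite normrMn mulr2n; have := sin_max (y * n.+1%:R); lra.
    by rewrite ger0_norm// heat_density_ge0.
  - exact: cvg_cst.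
  - by rewrite -[X in _ --> X](mulr0 2); apply: cvgMr; exact: cvg_heat.
exact: (cvg_unique _ h1 h2).
Unshelve. all: by end_near. Qed.

(** By [integralG] the left-hand side [g] solves [g' y = - v * y * g y], so
    [g y * expR (y ^+ 2 * v / 2)] is constant, with value 1 at 0. *)
Lemma heat_density_char_fun (xi : R) :
  \int[mu]_z (cos (xi * z) * h z) = expR (- (xi ^+ 2 * v / 2)).
Proof.
pose g (y : R) := \int[mu]_z (cos (y * z) * h z).
have dg (y : R) : is_derive y (1 : R) g (- (v * y * g y)).
  have -> : - (v * y * g y) = \int[mu]_z (- (sin (y * z) * (z * h z))).
    have := integralG y; rewrite /G RintegralB//; last 2 first.
    - exact: (integrableZl_EFin _ _ _ _ _ (int_cos y)).
    - exact: (integrableZl_EFin _ _ _ _ _ (int_sin y)).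
    rewrite !RintegralZl//.
    rewrite -/(g y) => /eqP; rewrite subr_eq0 => /eqP E.
    under [RHS]eq_Rintegral do rewrite -mulN1r.
    rewrite RintegralZl//.
    by rewrite -mulrA E mulVKf ?gt_eqF// mulN1r.
  apply: (@is_derive_Rintegral _ _ _ mu (fun y z => cos (y * z) * h z)
    (fun y z => - (sin (y * z) * (z * h z))) (fun z => `|z * h z|) y 1).
  - exact: ltr01.
  - by move=> x _; exact: int_cos.
  - move=> x z; apply: is_derive_eq; rewrite /GRing.scale/=; ring.
  - exact: int_id_heat.
  - by move=> x z _; rewrite normrN normrM ler_piMl// sin_max.
have dE (y : R) : is_derive y (1 : R) (fun y => g y * expR (y ^+ 2 * v / 2)) 0.
  have := dg y => ?; apply: is_derive_eq; rewrite /GRing.scale/=; by field.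
have := is_derive_0_is_cst xi 0 dE.
have -> : g 0 = 1.
  rewrite -integral_heat_density; apply: eq_Rintegral => z _.
  by rewrite mul0r cos0 mul1r.
rewrite expr0n !mul0r expR0 mulr1 -/(g xi) expRN => /(canRL (mulfK _)) ->.
  by rewrite mul1r.
by rewrite gt_eqF// expR_gt0.
Qed.

End heat_density.

(** * From characteristic functions to Laplace transforms *)

Section bounded_fubini.
Context {d} {T : measurableType d} {R : realType}.
Notation leb := (@lebesgue_measure R).
Variable mu : {finite_measure set T -> \bar R}.

Lemma integrable_bounded (f : T -> R) (M : R) : measurable_fun setT f ->
  (forall x, `|f x| <= M) -> mu.-integrable setT (EFin \o f).
Proof.
move=> mf fM; apply: measurable_bounded_integrable => //.
  by rewrite -ge0_fin_numE//; exact: fin_num_measure.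
exists M; split; first exact: num_real.
by move=> x Mx u _ /=; exact: le_trans (fM u) (ltW Mx).
Qed.

Variables (h : T * R -> R) (M : R).
Hypotheses (mh : measurable_fun setT h) (hM : forall p, `|h p| <= M).

Let mh1 u : measurable_fun setT (fun x => h (x, u)).
Proof. by apply: (@measurableT_comp _ _ _ _ _ _ h) => //; exact: pair2_measurable. Qed.

Let mh2 x : measurable_fun setT (fun u => h (x, u)).
Proof. by apply: (@measurableT_comp _ _ _ _ _ _ h) => //; exact: pair1_measurable. Qed.

(** Adding [M] makes the integrand nonnegative, so that Tonelli gives measurability; as [mu] is
    finite, the constant can be subtracted again. *)
Lemma measurable_fun_bounded_Rintegral :
  measurable_fun setT (fun u => \int[mu]_x h (x, u)).
Proof.
have -> : (fun u => \int[mu]_x h (x, u)) =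
    (fun u => \int[mu]_x (h (x, u) + M) - \int[mu]_x M).
  apply/funext => u; rewrite RintegralD ?addrK//.
    by apply: (@integrable_bounded _ M) => // x; exact: hM.
  by apply: (@integrable_bounded _ `|M|) => // x; rewrite lexx.
apply: measurable_funB => //.
apply: (@measurableT_comp _ _ _ _ _ _ (@fine R)); first exact: fine_measurable.
apply: (@measurable_fun_fubini_tonelli_G _ _ _ _ _ mu (fun p => (h p + M)%:E)).
  by apply/measurable_EFinP; exact: measurable_funD.
by move=> p; rewrite lee_fin; have := hM p; rewrite ler_norml => /andP[]; lra.
Qed.

Lemma cauchy_kernel_fubini :
  \int[leb]_u (cauchy_kernel u * \int[mu]_x h (x, u)) =
  \int[mu]_x \int[leb]_u (cauchy_kernel u * h (x, u)).
Proof.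
pose f (p : T * R) := (cauchy_kernel p.2 * h p)%:E.
have mf : measurable_fun setT f.
  apply/measurable_EFinP; apply: measurable_funM => //.
  apply: (@measurableT_comp _ _ _ _ _ _ (@cauchy_kernel R) _ snd) => //.
  exact: measurable_cauchy_kernel.
have M0 : 0 <= M by apply: le_trans (hM (point, 0)); exact: normr_ge0.
have fi : (mu \x leb)%E.-integrable setT f.
  apply/integrable12ltyP => //.
  apply: (@le_lt_trans _ _ (\int[mu]_x (M * cauchy_mass)%:E)%E).
    apply: ge0_le_integral => //.
    - by move=> x _; exact: integral_ge0.
    - apply: (@measurable_fun_fubini_tonelli_F _ _ _ _ _ leb (fun p => `|f p|%E)) => //.
      exact: measurableT_comp.
    - move=> x _; rewrite /cauchy_mass EFinM.
      rewrite /Rintegral fineK; last first.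
        by apply: integrable_fin_num => //; exact: integrable_cauchy_kernel.
      rewrite -ge0_integralZl//.
      + apply: ge0_le_integral => //.
        * apply/measurable_EFinP; apply: measurableT_comp => //.
          by apply: measurable_funM; [exact: measurable_cauchy_kernel|exact: mh2].
        * apply/measurable_EFinP; apply: measurable_funM => //.
          exact: measurable_cauchy_kernel.
        * move=> u _; rewrite /f/= -EFinM lee_fin normrM ger0_norm ?cauchy_kernel_ge0//.
          by rewrite mulrC ler_wpM2r// cauchy_kernel_ge0.
      + by apply/measurable_EFinP; exact: measurable_cauchy_kernel.
      + by move=> u _; rewrite lee_fin cauchy_kernel_ge0.
  rewrite integral_cst// ltey_eq fin_numM//.
  exact: fin_num_measure.
rewrite /Rintegral; congr fine.
transitivity (\int[leb]_u \int[mu]_x f (x, u))%E.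
  apply: eq_integral => u _; rewrite EFinM fineK; last first.
    by apply: integrable_fin_num => //; apply: (@integrable_bounded _ M) => // x; exact: hM.
  rewrite -integralZl//; last first.
    by apply: (@integrable_bounded _ M) => // x; exact: hM.
transitivity (\int[mu]_x \int[leb]_u f (x, u))%E.
  by rewrite (Fubini fi).
apply: eq_integral => x _; rewrite fineK//.
by apply: integrable_fin_num => //; apply: (@integrable_kernelM _ _ M) => // u; exact: hM.
Qed.

End bounded_fubini.

(** Trades a domain of finite measure for a finite measure on the whole space, the setting of the
    kernel lemmas. *)
Lemma Rintegral_mfrestr {d} {T : measurableType d} {R : realType}
    (mu : {measure set T -> \bar R}) (D : set T) (mD : measurable D)
    (muD : (mu D < +oo)%E) (f : T -> R) (M : R) :
  measurable_fun setT f -> (forall x, `|f x| <= M) ->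
  \int[mfrestr mD muD]_x f x = \int[mu]_(x in D) f x.
Proof.
move=> mf fM; rewrite /Rintegral; congr fine.
rewrite (negligible_integral (N := ~` D)) ?setTD ?setCK//.
- apply: eq_measure_integral => A mA AD.
  by transitivity (mu (A `&` D)) => //; rewrite setIidl.
- exact: measurableC.
- exact: (integrable_bounded _ _ _ mf fM).
- by transitivity (mu (~` D `&` D)) => //; rewrite setICl measure0.
Qed.

(** * Unit complex numbers and bounded complex-valued functions *)

Section cis.
Context {R : realType}.

Definition cis (x : R) : R[i] := cos x +i* sin x.

Lemma cisD x y : cis (x + y) = cis x * cis y.
Proof. by rewrite /cis cosD sinD; simpc; congr (_ +i* _); rewrite addrC. Qed.

Lemma cis0 : cis 0 = 1.
Proof. by rewrite /cis cos0 sin0. Qed.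

Lemma ReM (z w : R[i]) : complex.Re (z * w) =
  complex.Re z * complex.Re w - complex.Im z * complex.Im w.
Proof. by case: z w => [a b] [c e]. Qed.

Lemma ImM (z w : R[i]) : complex.Im (z * w) =
  complex.Re z * complex.Im w + complex.Im z * complex.Re w.
Proof. by case: z w => [a b] [c e]. Qed.

Lemma ReD (z w : R[i]) : complex.Re (z + w) = complex.Re z + complex.Re w.
Proof. by case: z w => [a b] [c e]. Qed.

Lemma ImD (z w : R[i]) : complex.Im (z + w) = complex.Im z + complex.Im w.
Proof. by case: z w => [a b] [c e]. Qed.

(** Phrased through real and imaginary parts, like [cintegral]. Closure under sums and products
    makes polynomials in a characteristic function integrable against the kernel. *)
Definition bounded_measurable {d} {T : measurableType d} (f : T -> R[i]) : Prop :=
  [/\ measurable_fun setT (fun x => complex.Re (f x)),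
      measurable_fun setT (fun x => complex.Im (f x)) &
      exists M, forall x, `|complex.Re (f x)| <= M /\ `|complex.Im (f x)| <= M].

Context {d} {T : measurableType d}.
Implicit Types f g : T -> R[i].

Lemma bounded_measurable_cst (z : R[i]) : bounded_measurable (fun _ : T => z).
Proof.
split => //; exists (Num.max `|complex.Re z| `|complex.Im z|) => _.
by rewrite !le_max !lexx orbT.
Qed.

Lemma bounded_measurableD f g : bounded_measurable f -> bounded_measurable g ->
  bounded_measurable (fun x => f x + g x).
Proof.
move=> [mf1 mf2 [M fM]] [mg1 mg2 [N gN]]; split.
- by under eq_fun do rewrite ReD; exact: measurable_funD.
- by under eq_fun do rewrite ImD; exact: measurable_funD.
- exists (M + N) => x; have [f1 f2] := fM x; have [g1 g2] := gN x.
  by rewrite ReD ImD; split; apply: le_trans (ler_normD _ _) _; exact: lerD.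
Qed.

Lemma bounded_measurableM f g : bounded_measurable f -> bounded_measurable g ->
  bounded_measurable (fun x => f x * g x).
Proof.
move=> [mf1 mf2 [M fM]] [mg1 mg2 [N gN]]; split.
- under eq_fun do rewrite ReM; apply: measurable_funB; exact: measurable_funM.
- under eq_fun do rewrite ImM; apply: measurable_funD; exact: measurable_funM.
- exists (M * N + M * N) => x; have [f1 f2] := fM x; have [g1 g2] := gN x.
  rewrite ReM ImM; split.
    by apply: le_trans (ler_normB _ _) _; rewrite !normrM; apply: lerD; exact: ler_pM.
  by apply: le_trans (ler_normD _ _) _; rewrite !normrM; apply: lerD; exact: ler_pM.
Qed.

Lemma bounded_measurableX f n : bounded_measurable f ->
  bounded_measurable (fun x => f x ^+ n).
Proof.
move=> bf; elim: n => [|n ih]; first exact: bounded_measurable_cst.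
by under eq_fun do rewrite exprS; exact: bounded_measurableM.
Qed.

Lemma bounded_measurable_cis (h : T -> R) : measurable_fun setT h ->
  bounded_measurable (fun x => cis (h x)).
Proof.
move=> mh; split.
- apply: (@measurableT_comp _ _ _ _ _ _ (@cos R)) => //.
  exact: continuous_measurable_fun (@continuous_cos R).
- apply: (@measurableT_comp _ _ _ _ _ _ (@sin R)) => //.
  exact: continuous_measurable_fun (@continuous_sin R).
- by exists 1 => x; rewrite cos_max sin_max.
Qed.

End cis.

Lemma bounded_measurable_comp {R : realType} {d d'} {T : measurableType d}
    {T' : measurableType d'} (g : T' -> T) (f : T -> R[i]) :
  measurable_fun setT g -> bounded_measurable f ->
  bounded_measurable (fun x => f (g x)).
Proof.
move=> mg [mf1 mf2 [M fM]]; split.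
- exact: (measurableT_comp mf1 mg).
- exact: (measurableT_comp mf2 mg).
- by exists M => x; exact: fM.
Qed.

(** * The kernel integral of polynomials in a characteristic function *)

Section compound.
Context {d} {T : measurableType d} {R : realType}.
Notation leb := (@lebesgue_measure R).
Variable mu : {finite_measure set T -> \bar R}.
Variable Y : T -> R.
Hypotheses (mY : measurable_fun setT Y) (Y0 : forall x, 0 <= Y x).
Notation k := cauchy_kernel.

(** [mu] is finite but not normalized: it stands for a truncated Levy measure. *)
Definition char_mean (u : R) : R[i] := cintegral mu setT (fun x => cis (Y x * u)).
Definition laplace_mean : R := \int[mu]_x expR (- Y x).

Let mYu : measurable_fun setT (fun p : T * R => Y p.1 * p.2).
Proof. by apply: measurable_funM => //; exact: measurableT_comp. Qed.

Let mYu1 (u : R) : measurable_fun setT (fun x => Y x * u).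
Proof. exact: measurable_funM. Qed.

Let bcis := bounded_measurable_cis _ mYu.
Let bcis1 u := bounded_measurable_cis _ (mYu1 u).

Let int_cos u : mu.-integrable setT (fun x => (cos (Y x * u))%:E).
Proof.
by have [mf _ _] := bcis1 u; apply: (@integrable_bounded _ _ _ _ _ 1) => // x; exact: cos_max.
Qed.

Let int_sin u : mu.-integrable setT (fun x => (sin (Y x * u))%:E).
Proof.
by have [_ mf _] := bcis1 u; apply: (@integrable_bounded _ _ _ _ _ 1) => // x; exact: sin_max.
Qed.

Let int_exp : mu.-integrable setT (fun x => (expR (- Y x))%:E).
Proof.
apply: (@integrable_bounded _ _ _ _ _ 1) => [|x].
  by apply: measurableT_comp => //; exact: measurableT_comp.
by rewrite ger0_norm ?expR_ge0// -expR0 ler_expR oppr_le0.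
Qed.

Lemma bounded_measurable_char_mean : bounded_measurable char_mean.
Proof.
have [m1 m2 _] := bcis; split.
- by apply: (measurable_fun_bounded_Rintegral _ _ 1 m1) => p; exact: cos_max.
- by apply: (measurable_fun_bounded_Rintegral _ _ 1 m2) => p; exact: sin_max.
- exists (\int[mu]_x 1) => u; rewrite /char_mean /cintegral/=; split.
  + apply: le_trans (le_normr_Rintegral measurableT (int_cos u)) _.
    apply: le_Rintegral => //.
    * exact: integrable_abse (int_cos u).
    * by apply: (@integrable_bounded _ _ _ _ _ 1) => // x; rewrite normr1.
    * by move=> x _; exact: cos_max.
  + apply: le_trans (le_normr_Rintegral measurableT (int_sin u)) _.
    apply: le_Rintegral => //.
    * exact: integrable_abse (int_sin u).
    * by apply: (@integrable_bounded _ _ _ _ _ 1) => // x; rewrite normr1.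
    * by move=> x _; exact: sin_max.
Qed.

(* [cauchy_transform] says that integration against the kernel sends [cis (c * u)] to
   [expR (- c)], which is multiplicative in [c >= 0]. *)
Lemma cauchy_transform_expr (p q : R) (n : nat) (c : R) : 0 <= c ->
  \int[leb]_u (k u * complex.Re (cis (c * u) * (p%:C + q%:C * char_mean u) ^+ n)) =
  cauchy_mass * (expR (- c) * (p + q * laplace_mean) ^+ n).
Proof.
(* The induction varies [c]: a factor [char_mean u] is written as an integral over [x], and after
   Fubini it shifts [c] to [Y x + c], which is again nonnegative. *)
elim: n c => [|n ih] c c0.
  rewrite expr0 mulr1 -cauchy_transform//.
  by apply: eq_Rintegral => u _; rewrite expr0 mulr1.
pose z u := (p%:C + q%:C * char_mean u) ^+ n.
have bz : bounded_measurable z.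
  apply: bounded_measurableX; apply: bounded_measurableD; first exact: bounded_measurable_cst.
  apply: bounded_measurableM; first exact: bounded_measurable_cst.
  exact: bounded_measurable_char_mean.
have bcz (e : R) : bounded_measurable (fun u : R => cis (e * u) * z u).
  by apply: bounded_measurableM => //; exact: bounded_measurable_cis.
have bcpz (e : R) : bounded_measurable (fun u : R => cis (e * u) * z u * char_mean u).
  by apply: bounded_measurableM => //; exact: bounded_measurable_char_mean.
have int_kRe (f : R -> R[i]) : bounded_measurable f ->
    leb.-integrable setT (fun u => (k u * complex.Re (f u))%:E).
  by move=> [mf _ [M fM]]; apply: (@integrable_kernelM _ _ M) => // u; have [] := fM u.
transitivity (\int[leb]_u (p * (k u * complex.Re (cis (c * u) * z u)) +
    q * (k u * complex.Re (cis (c * u) * z u * char_mean u)))).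
  apply: eq_Rintegral => u _; rewrite exprS -/(z u).
  have -> : cis (c * u) * ((p%:C + q%:C * char_mean u) * z u) =
    p%:C * (cis (c * u) * z u) + q%:C * (cis (c * u) * z u * char_mean u) by ring.
  by rewrite ReD !(ReM _%:C)/= !mul0r !subr0; ring.
rewrite RintegralD//; last 2 first.
- exact: (integrableZl_EFin _ _ _ _ _ (int_kRe _ (bcz c))).
- exact: (integrableZl_EFin _ _ _ _ _ (int_kRe _ (bcpz c))).
rewrite !RintegralZl//; last 2 first.
- exact: int_kRe.
- exact: int_kRe.
rewrite ih//.
pose h (w : T * R) := complex.Re (cis (Y w.1 * w.2) * (cis (c * w.2) * z w.2)).
have [mh _ [M hM]] : bounded_measurable
    (fun w : T * R => cis (Y w.1 * w.2) * (cis (c * w.2) * z w.2)).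
  apply: bounded_measurableM => //.
  exact: (bounded_measurable_comp snd (fun u => cis (c * u) * z u)).
have -> : \int[leb]_u (k u * complex.Re (cis (c * u) * z u * char_mean u)) =
    \int[leb]_u (k u * \int[mu]_x h (x, u)).
  apply: eq_Rintegral => u _; congr (_ * _).
  rewrite /h; under [RHS]eq_Rintegral do rewrite ReM/= mulrC [sin _ * _]mulrC.
  rewrite RintegralB//; last 2 first.
  - exact: (integrableZl_EFin _ _ _ _ _ (int_cos u)).
  - exact: (integrableZl_EFin _ _ _ _ _ (int_sin u)).
  rewrite !RintegralZl//; last 2 first.
  - exact: int_sin.
  - exact: int_cos.
  by rewrite ReM.
rewrite (cauchy_kernel_fubini _ _ M)//; last by move=> w; have [] := hM w.
have -> : \int[mu]_x \int[leb]_u (k u * h (x, u)) =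
    \int[mu]_x (cauchy_mass * (expR (- c) * (p + q * laplace_mean) ^+ n) * expR (- Y x)).
  apply: eq_Rintegral => x _; rewrite /h/=.
  under eq_Rintegral do rewrite mulrA -cisD -mulrDl.
  rewrite ih; last by rewrite addr_ge0.
  by rewrite opprD expRD; ring.
rewrite RintegralZl// -/laplace_mean exprS; ring.
Qed.

End compound.

(** * The complex exponential as a limit of powers *)

Section cexp.
Context {R : realType}.
Implicit Types z w : R[i].

Lemma cexpE z : cexp z = (expR (complex.Re z))%:C * cis (complex.Im z).
Proof. by rewrite /cexp /cis; simpc. Qed.

Lemma cexp_imaginary (x : R) : cexp (0 +i* x) = cis x.
Proof. by rewrite cexpE/= expR0 mul1r. Qed.

Lemma cexpD z w : cexp (z + w) = cexp z * cexp w.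
Proof. by rewrite !cexpE ReD ImD expRD cisD rmorphM/=; ring. Qed.

Lemma cexpX z n : cexp (n%:R * z) = cexp z ^+ n.
Proof.
elim: n => [|n ih]; first by rewrite mul0r cexp_imaginary cis0.
by rewrite exprS -ih -cexpD -natr1 mulrDl mul1r addrC.
Qed.

Lemma norm_complex_le z : `|z| <= (`|complex.Re z| + `|complex.Im z|)%:C.
Proof.
rewrite {1}(complexE z) (le_trans (ler_normD _ _))// normrM rmorphD/= !normc_def/=.
by rewrite !expr0n/= !addr0 add0r expr1n sqrtr1 mul1r !sqrtr_sqr.
Qed.

Lemma norm_ReM_le z w : `|complex.Re (z * w)|%:C <= `|z| * `|w|.
Proof. by rewrite -normrM; exact: normc_ge_Re. Qed.

Lemma norm_cexp z : `|cexp z| = (expR (complex.Re z))%:C.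
Proof.
rewrite cexpE normrM normc_def/= expr0n addr0 sqrtr_sqr ger0_norm ?expR_ge0//.
by rewrite normc_def/= cos2Dsin2 sqrtr1 mulr1.
Qed.

Lemma norm_cis (x : R) : `|cis x| = 1.
Proof. by rewrite -cexp_imaginary norm_cexp expR0. Qed.

(** The Lipschitz bound of a power on the disc of radius [M], by telescoping. *)
Lemma norm_subX_le (F : numDomainType) (a b M : F) n : `|a| <= M -> `|b| <= M ->
  `|a ^+ n.+1 - b ^+ n.+1| <= n.+1%:R * M ^+ n * `|a - b|.
Proof.
move=> aM bM; have M0 : 0 <= M by exact: le_trans aM.
elim: n => [|n ih]; first by rewrite !expr1 expr0 mulr1 mul1r.
have -> : a ^+ n.+2 - b ^+ n.+2 = a * (a ^+ n.+1 - b ^+ n.+1) + (a - b) * b ^+ n.+1.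
  by rewrite (exprS a n.+1) (exprS b n.+1); ring.
apply: le_trans (ler_normD _ _) _; rewrite !normrM normrX.
have -> : n.+2%:R * M ^+ n.+1 * `|a - b| =
    M * (n.+1%:R * M ^+ n * `|a - b|) + `|a - b| * M ^+ n.+1.
  by rewrite -(natr1 n.+1) exprS; ring.
apply: lerD; first by apply: ler_pM.
by apply: ler_wpM2l => //; exact: lerXn2r.
Qed.

Lemma norm_oneD_le n w (r : R) : `|w| <= r%:C ->
  `|1 + (n.+1%:R^-1)%:C * w| <= (expR (n.+1%:R^-1 * r))%:C.
Proof.
move=> wr.
apply: (@le_trans _ _ (1 + n.+1%:R^-1 * r)%:C); last by rewrite lecR expR_ge1Dx.
apply: le_trans (ler_normD _ _) _; rewrite normr1 rmorphD rmorphM/= lerD2l normrM.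
rewrite ger0_norm ?ler0c ?invr_ge0//.
by apply: ler_wpM2l => //; rewrite ler0c invr_ge0.
Qed.

(** The bound does not depend on [n], so it serves as domination in the limit of the kernel
    integrals. *)
Lemma norm_compound_le n w (r : R) : `|w| <= r%:C ->
  `|(1 + (n.+1%:R^-1)%:C * w) ^+ n.+1| <= (expR r)%:C.
Proof.
move=> wr; rewrite normrX.
have -> : expR r = expR (n.+1%:R^-1 * r) ^+ n.+1.
  by rewrite -expRM_natl mulrA mulfV ?mul1r// pnatr_eq0.
rewrite rmorphXn/=; apply: lerXn2r; [by rewrite nnegrE|by rewrite nnegrE ler0c expR_ge0|].
exact: norm_oneD_le.
Qed.

Let cvg_derive0 (f : R -> R) (l : R) : is_derive (0 : R) (1 : R) f l ->
  n.+1%:R * (f n.+1%:R^-1 - f 0) @[n --> \oo] --> l.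
Proof.
move=> [df fl].
have : h^-1 *: (f (h *: 1 + 0) - f 0) @[h --> 0^'] --> l.
  by rewrite -fl; exact: df.
move=> /cvgr_dnbhsP /(_ (fun n => n.+1%:R^-1)) h.
rewrite (_ : (fun n => _) =
    (fun n => n.+1%:R^-1^-1 *: (f (n.+1%:R^-1 *: 1 + 0) - f 0))); last first.
  by apply/funext => n; rewrite invrK addr0 /GRing.scale/= mulr1.
apply: h; split; first by move=> n; rewrite invr_eq0 pnatr_eq0.
exact: cvg_harmonic.
Qed.

Let derRe (x y : R) : is_derive (0 : R) (1 : R) (fun s => expR (s * x) * cos (s * y)) x.
Proof.
apply: is_derive_eq.
by rewrite /GRing.scale/= !mul0r expR0 cos0 sin0; ring.
Qed.

Let derIm (x y : R) : is_derive (0 : R) (1 : R) (fun s => expR (s * x) * sin (s * y)) y.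
Proof.
apply: is_derive_eq.
by rewrite /GRing.scale/= !mul0r expR0 cos0 sin0; ring.
Qed.

(** The number [b = cexp (w / n.+1)] has [cexp w] as its power [n.+1] and differs from
    [1 + w / n.+1] by [o(1 / n)], because [s -> cexp (s w)] has derivative [w] at 0. The sequences
    [e] and [f] are the real and imaginary parts of [n.+1] times this difference, and [norm_subX_le]
    carries it to the powers. *)
Lemma cvg_compound (v w : R[i]) :
  complex.Re (v * (1 + (n.+1%:R^-1)%:C * w) ^+ n.+1) @[n --> \oo] -->
  complex.Re (v * cexp w).
Proof.
pose r := `|complex.Re w| + `|complex.Im w|.
have wr : `|w| <= r%:C by exact: norm_complex_le.
have r0 : 0 <= r by rewrite addr_ge0.
pose V := `|complex.Re v| + `|complex.Im v|.
have vV : `|v| <= V%:C by exact: norm_complex_le.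
pose x := complex.Re w; pose y := complex.Im w.
pose e n := n.+1%:R * (expR (n.+1%:R^-1 * x) * cos (n.+1%:R^-1 * y) - 1) - x.
pose f n := n.+1%:R * (expR (n.+1%:R^-1 * x) * sin (n.+1%:R^-1 * y)) - y.
have ce : e n @[n --> \oo] --> (0 : R).
  rewrite -[X in _ --> X](subrr x); apply: cvgB; last exact: cvg_cst.
  have := cvg_derive0 _ _ (derRe x y).
  by rewrite !mul0r expR0 cos0 mul1r.
have cf : f n @[n --> \oo] --> (0 : R).
  rewrite -[X in _ --> X](subrr y); apply: cvgB; last exact: cvg_cst.
  have := cvg_derive0 _ _ (derIm x y).
  by rewrite !mul0r sin0 mulr0; under eq_fun do rewrite subr0.
apply/subr_cvg0; apply: norm_cvg0.
apply: (@squeeze_cvgr _ _ _ _ (cst 0) (fun n => V * expR r * (`|e n| + `|f n|))); last 2 first.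
- exact: cvg_cst.
- rewrite -[X in _ --> X](mulr0 (V * expR r)); apply: cvgMr.
  by rewrite -[X in _ --> X](addr0 0); apply: cvgD; rewrite -(normr0 R); exact: cvg_norm.
apply: nearW => n; rewrite normr_ge0/=.
rewrite -lecR.
set a := 1 + (n.+1%:R^-1)%:C * w.
pose b := cexp ((n.+1%:R^-1)%:C * w).
have -> : complex.Re (v * a ^+ n.+1) - complex.Re (v * cexp w) =
    complex.Re (v * (a ^+ n.+1 - b ^+ n.+1)).
  rewrite mulrBr raddfB/=; congr (_ - complex.Re (v * _)).
  by rewrite -cexpX mulrA fmorphV rmorph_nat mulfV ?mul1r// pnatr_eq0.
apply: le_trans (norm_ReM_le _ _) _.
rewrite -mulrA rmorphM/=; apply: ler_pM => //.
have aM : `|a| <= (expR (n.+1%:R^-1 * r))%:C by exact: norm_oneD_le.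
have Rw : complex.Re ((n.+1%:R^-1)%:C * w) = n.+1%:R^-1 * x.
  by rewrite ReM/= mul0r subr0.
have Iw : complex.Im ((n.+1%:R^-1)%:C * w) = n.+1%:R^-1 * y.
  by rewrite ImM/= mul0r addr0.
have bM : `|b| <= (expR (n.+1%:R^-1 * r))%:C.
  rewrite norm_cexp lecR ler_expR Rw ler_wpM2l ?invr_ge0//.
  by rewrite /r (le_trans (ler_norm _))// lerDl.
apply: le_trans (norm_subX_le _ _ _ _ n aM bM) _.
rewrite [n.+1%:R * _]mulrC -mulrA rmorphM/=.
apply: ler_pM.
- by rewrite -rmorphXn ler0c exprn_ge0 ?expR_ge0.
- by rewrite mulr_ge0.
- rewrite -rmorphXn lecR -expRM_natl ler_expR mulrA ler_piMl//.
  by rewrite ler_pdivrMr ?ltr0n// mul1r ler_nat.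
- have -> : n.+1%:R * `|a - b| = `|n.+1%:R * (b - a)|.
    by rewrite normrM normr_nat distrC.
  apply: le_trans (norm_complex_le _) _; rewrite lecR.
  have -> : complex.Re (n.+1%:R * (b - a)) = e n.
    rewrite -(rmorph_nat (real_complex R)) ReM/= mul0r subr0.
    have -> : complex.Re (b - a) = complex.Re b - complex.Re a by exact: raddfB.
    have -> : complex.Re b = expR (n.+1%:R^-1 * x) * cos (n.+1%:R^-1 * y).
      by rewrite /b /cexp/= Rw Iw.
    by rewrite /a ReD Rw [complex.Re 1]/= /e; field; rewrite addrC natr1 pnatr_eq0.
  have -> : complex.Im (n.+1%:R * (b - a)) = f n.
    rewrite -(rmorph_nat (real_complex R)) ImM/= mul0r addr0.
    have -> : complex.Im (b - a) = complex.Im b - complex.Im a by exact: raddfB.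
    have -> : complex.Im b = expR (n.+1%:R^-1 * x) * sin (n.+1%:R^-1 * y).
      by rewrite /b /cexp/= Rw Iw.
    by rewrite /a ImD Iw [complex.Im 1]/= /f; field; rewrite addrC natr1 pnatr_eq0.
  by [].
Qed.

End cexp.

Lemma char_funE {d} {Omega : measurableType d} {R : realType}
    (P : probability Omega R) (Y : Omega -> R) (xi : R) :
  char_fun P Y xi = (\int[P]_w cos (xi * Y w)) +i* (\int[P]_w sin (xi * Y w)).
Proof.
by rewrite /char_fun /cintegral; congr (_ +i* _); apply: eq_Rintegral => w _;
  rewrite cexp_imaginary.
Qed.

Lemma Re_cis_cexp {R : realType} (b t : R) (w : R[i]) :
  complex.Re (cis b * cexp (t%:C * w)) =
  expR (t * complex.Re w) * cos (b + t * complex.Im w).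
Proof.
rewrite cexpE mulrCA -cisD ReM ImM/= !mul0r !subr0 ReM/= mul0r subr0.
by rewrite addr0.
Qed.

(** * From powers to exponentials: finite Levy measures *)

Section compound_poisson.
Context {d} {T : measurableType d} {R : realType}.
Notation leb := (@lebesgue_measure R).
Variable mu : {finite_measure set T -> \bar R}.
Variable Y : T -> R.
Hypotheses (mY : measurable_fun setT Y) (Y0 : forall x, 0 <= Y x).
Notation k := cauchy_kernel.

(** The factor of [k u] is [Re (cis (c * u) * cexp (w u))]; for [t >= 0], [cexp (w u)] is the
    characteristic function of a compound Poisson variable whose jumps have intensity [t] times the
    image of [mu] under [Y]. *)
Lemma cauchy_transform_compound_poisson (t c : R) : 0 <= c ->
  \int[leb]_u (k u * (expR (t * (\int[mu]_x cos (Y x * u) - fine (mu setT))) *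
                      cos (c * u + t * \int[mu]_x sin (Y x * u)))) =
  cauchy_mass * (expR (- c) * expR (t * (laplace_mean mu Y - fine (mu setT)))).
Proof.
move=> c0; set lam := fine (mu setT).
pose w u : R[i] := t%:C * (char_mean mu Y u - lam%:C).
have bw : bounded_measurable w.
  apply: bounded_measurableM; first exact: bounded_measurable_cst.
  apply: bounded_measurableD; last exact: bounded_measurable_cst.
  exact: bounded_measurable_char_mean.
pose f_ n u := k u * complex.Re (cis (c * u) * (1 + (n.+1%:R^-1)%:C * w u) ^+ n.+1).
pose f u := k u * complex.Re (cis (c * u) * cexp (w u)).
have fE u : f u = k u * (expR (t * (\int[mu]_x cos (Y x * u) - lam)) *
                      cos (c * u + t * \int[mu]_x sin (Y x * u))).
  by rewrite /f /w Re_cis_cexp ReD ImD /= oppr0 addr0.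
have [mw1 mw2 [M wM]] := bw.
have cvf : \int[leb]_u f_ n u @[n --> \oo] --> \int[leb]_u f u.
  apply: (@cvg_Rintegral _ _ _ leb setT f_ f (fun u => k u * expR (M + M))) => //.
  - move=> n; apply: measurable_funM; first exact: measurable_cauchy_kernel.
    suff [] : bounded_measurable
        (fun u : R => cis (c * u) * (1 + (n.+1%:R^-1)%:C * w u) ^+ n.+1) by [].
    apply: bounded_measurableM; first exact: bounded_measurable_cis.
    apply: bounded_measurableX; apply: bounded_measurableD; first exact: bounded_measurable_cst.
    by apply: bounded_measurableM => //; exact: bounded_measurable_cst.
  - rewrite (_ : f = fun u => k u * (expR (complex.Re (w u)) * cos (c * u + complex.Im (w u)))).
      apply: measurable_funM; first exact: measurable_cauchy_kernel.
      apply: measurable_funM; first exact: measurableT_comp.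
      apply: (@measurableT_comp _ _ _ _ _ _ (@cos R)).
        exact: continuous_measurable_fun (@continuous_cos R).
      by apply: measurable_funD => //; exact: measurable_funM.
    apply/funext => u; rewrite /f; congr (_ * _).
    by have := Re_cis_cexp (c * u) 1 (w u); rewrite !mul1r.
  - apply: aeW => u _; apply: cvgMr; exact: cvg_compound.
  - apply: (@integrable_kernelM _ (fun=> expR (M + M)) (expR (M + M))) => // u.
    by rewrite ger0_norm ?expR_ge0.
  - move=> n u _; rewrite /f_ normrM ger0_norm ?cauchy_kernel_ge0//.
    apply: ler_wpM2l; first exact: cauchy_kernel_ge0.
    rewrite -lecR; apply: le_trans (norm_ReM_le _ _) _; rewrite norm_cis mul1r.
    apply: norm_compound_le; apply: le_trans (norm_complex_le _) _.
    by have [h1 h2] := wM u; rewrite lecR lerD.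
have f_E n : \int[leb]_u f_ n u = cauchy_mass * (expR (- c) *
    (1 + n.+1%:R^-1 * (t * (laplace_mean mu Y - lam))) ^+ n.+1).
  (* These are the constant term and the coefficient of [char_mean mu Y u] in [1 + w u / n.+1]. *)
  have := @cauchy_transform_expr _ _ _ mu Y mY Y0
    (1 - n.+1%:R^-1 * t * lam) (n.+1%:R^-1 * t) n.+1 c c0.
  rewrite -[n.+1%:R^-1 * t * lam]mulrA.
  have -> : 1 - n.+1%:R^-1 * (t * lam) + n.+1%:R^-1 * t * laplace_mean mu Y =
     1 + n.+1%:R^-1 * (t * (laplace_mean mu Y - lam)) by ring.
  move=> <-; apply: eq_Rintegral => u _; rewrite /f_ /w; congr (_ * complex.Re (_ * _ ^+ _)).
  by rewrite rmorphB !rmorphM rmorph1 -/(_%:C); ring.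
have cvR : \int[leb]_u f_ n u @[n --> \oo] -->
    cauchy_mass * (expR (- c) * expR (t * (laplace_mean mu Y - lam))).
  rewrite (_ : (fun n => _) = fun n => cauchy_mass * (expR (- c) *
    (1 + n.+1%:R^-1 * (t * (laplace_mean mu Y - lam))) ^+ n.+1)); last first.
    by apply/funext => n; exact: f_E.
  apply: cvgMr; apply: cvgMr.
  have := cvg_compound 1 (t * (laplace_mean mu Y - lam))%:C.
  rewrite mul1r /= cos0 mulr1.
  rewrite (_ : (fun n => _) = fun n : nat =>
    (1 + n.+1%:R^-1 * (t * (laplace_mean mu Y - lam))) ^+ n.+1)//.
  by apply/funext => n; rewrite mul1r -rmorphM -(rmorph1 (real_complex R)) -rmorphD -rmorphXn.
rewrite -(cvg_unique (@Rhausdorff R) cvf cvR).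
by apply: eq_Rintegral => u _; rewrite fE.
Qed.

End compound_poisson.

(** * Infinite Levy measures by truncation at 0 *)

Section subordinator_exponent.
Context {R : realType}.
Notation leb := (@lebesgue_measure R).
Notation k := cauchy_kernel.
Variable nu : {measure set R -> \bar R}.
Local Notation D := (`]0, +oo[%classic : set R).
Hypothesis nu_min : (\int[nu]_(y in D) (Num.min y 1)%:E < +oo)%E.

Let mD : measurable D. Proof. exact: measurable_itv. Qed.

Lemma integrable_min1 : nu.-integrable D (fun y => (Num.min y 1)%:E).
Proof.
apply/integrableP; split.
  by apply/measurable_EFinP; exact: measurable_minr.
under eq_integral => y.
  rewrite inE/= in_itv/= andbT => y0.
  rewrite ger0_norm; last by rewrite le_min (ltW y0) ler01.
  over.
exact: nu_min.
Qed.

Lemma integrable_le_min1 (f : R -> R) (C : R) : measurable_fun D f ->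
  (forall y, 0 < y -> `|f y| <= C * Num.min y 1) -> nu.-integrable D (EFin \o f).
Proof.
move=> mf fC; apply: (@le_integrable _ _ _ nu _ mD _ (fun y => (C * Num.min y 1)%:E)).
- exact/measurable_EFinP.
- move=> y; rewrite /= in_itv/= andbT => y0; rewrite lee_fin.
  by rewrite (le_trans (fC _ y0))// ler_norm.
- exact: (integrableZl_EFin _ _ _ _ _ integrable_min1).
Qed.

Let cut n : set R := `]n.+1%:R^-1, +oo[%classic.

Let mcut n : measurable (cut n). Proof. exact: measurable_itv. Qed.

Let cut_D n : cut n `<=` D.
Proof.
move=> y; rewrite /cut/= !in_itv/= !andbT; apply: lt_trans.
by rewrite invr_gt0.
Qed.

(** On [cut n] the constant 1 is at most [n.+1 * min y 1], which is integrable. *)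
Let nu_cut (n : nat) : (nu (cut n) < +oo)%E.
Proof.
have /integrableP[_] : nu.-integrable (cut n) (EFin \o cst (1 : R)).
  apply: (@le_integrable _ _ _ nu _ (mcut n) _ (fun y => (n.+1%:R * Num.min y 1)%:E)).
  - by apply/measurable_EFinP.
  - move=> y; rewrite /cut/= in_itv/= andbT => y0; rewrite lee_fin normr1.
    apply: le_trans _ (ler_norm _).
    rewrite -ler_pdivrMl ?ltr0n// mulr1 le_min (ltW y0)/=.
    by rewrite invf_le1 ?ltr0n// ler1n.
  - apply: integrableZl_EFin => //.
    by apply: (@integrableS _ _ _ _ D) => //; exact: integrable_min1.
under eq_integral do rewrite /= normr1.
by rewrite integral_cst ?mul1e.
Qed.

Let nuc (n : nat) := mfrestr (mcut n) (nu_cut n).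

Let integral_nuc (n : nat) (f : R -> R) (M : R) : measurable_fun setT f ->
  (forall y, `|f y| <= M) ->
  \int[nuc n]_y f y = \int[nu]_(y in cut n) f y.
Proof. exact: Rintegral_mfrestr. Qed.

Let le_min1 (C b y x : R) : 0 < y -> 0 <= C -> 0 <= b ->
  x <= C * y -> x <= b -> x <= (C + b) * Num.min y 1.
Proof. by move=> y0 C0 b0 xC xb; rewrite /Num.min; case: ltP => y1; nra. Qed.

Lemma integrable_cos1 (v : R) : nu.-integrable D (fun y => (cos (v * y) - 1)%:E).
Proof.
(* For [y <= 1] the quadratic bound on [1 - cos] is weakened to [v ^+ 2 * y]; for larger [y] the
   bound 2 is used. *)
apply: (@integrable_le_min1 _ (v ^+ 2 + 2)).
  apply: measurable_funTS; apply: measurable_funB => //.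
  apply: (@measurableT_comp _ _ _ _ _ _ (@cos R)).
    exact: continuous_measurable_fun (@continuous_cos R).
  exact: measurable_funM.
move=> y y0.
have h1 : `|cos (v * y) - 1| <= v ^+ 2 * y ^+ 2.
  by rewrite distrC -exprMn; exact: onem_cos_le.
have h2 : `|cos (v * y) - 1| <= 2.
  apply: le_trans (ler_normB _ _) _; rewrite normr1.
  by have := cos_max (v * y); lra.
have v2 := sqr_ge0 v.
rewrite /Num.min; case: ltP => y1; last lra.
by apply: le_trans h1 _; nra.
Qed.

Lemma integrable_sin (v : R) : nu.-integrable D (fun y => (sin (v * y))%:E).
Proof.
apply: (@integrable_le_min1 _ (`|v| + 1)).
  apply: measurable_funTS.
  apply: (@measurableT_comp _ _ _ _ _ _ (@sin R)).
    exact: continuous_measurable_fun (@continuous_sin R).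
  exact: measurable_funM.
move=> y y0; apply: le_min1 => //; last exact: sin_max.
by apply: le_trans (normr_sin_le _) _; rewrite normrM [`|y|]gtr0_norm.
Qed.

Lemma integrable_expR1 (a : R) : 0 <= a ->
  nu.-integrable D (fun y => (expR (- (a * y)) - 1)%:E).
Proof.
move=> a0; apply: (@integrable_le_min1 _ (a + 1)).
  apply: measurable_funTS; apply: measurable_funB => //.
  by apply: measurableT_comp => //; apply: measurableT_comp => //; exact: measurable_funM.
move=> y y0.
have e1 : expR (- (a * y)) <= 1 by rewrite -expR0 ler_expR oppr_le0 mulr_ge0// ltW.
have e0 := expR_ge0 (- (a * y)).
have e2 := expR_ge1Dx (- (a * y)).
rewrite ler0_norm ?subr_le0//.
by apply: le_min1 => //; move: (expR _) e0 e1 e2 => e; lra.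
Qed.

Let cvg_cut (f : R -> R) : nu.-integrable D (EFin \o f) ->
  \int[nu]_(y in cut n) f y @[n --> \oo] --> \int[nu]_(y in D) f y.
Proof.
move=> fi; have /integrableP[/measurable_EFinP mf _] := fi.
rewrite (_ : (fun n => _) = fun n => \int[nu]_(y in D) (f y * \1_(cut n) y)); last first.
  apply/funext => n; rewrite Rintegral_mkcond [RHS]Rintegral_mkcond.
  apply: eq_Rintegral => y _; rewrite !patchE indicE.
  case: ifPn => [yc|yc]; last by rewrite mulr0 if_same.
  by rewrite mem_set ?mulr1//; apply: (@cut_D n); rewrite -inE.
apply: (@cvg_Rintegral _ _ _ nu D _ _ (fun y => `|f y|)) => //.
- by move=> n; apply: measurable_funM => //; apply: measurable_indic.
- apply: aeW => y; rewrite /= in_itv/= andbT => y0; apply: cvg_near_cst.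
  near=> n; rewrite indicE mem_set ?mulr1// /cut/= in_itv/= andbT.
  rewrite invf_plt ?posrE// (@lt_le_trans _ _ n%:R)// ?ler_nat//.
  by near: n; exact: nbhs_infty_gtr.
- exact: integrable_abse fi.
- move=> n y _; rewrite normrM ler_piMr// indicE.
  by case: (_ \in _); rewrite ?normr1 ?normr0.
Unshelve. all: by end_near. Qed.

Variables a t c : R.
Hypotheses (a0 : 0 <= a) (t0 : 0 <= t) (c0 : 0 <= c).

(** The absolute value makes [Y] nonnegative on the whole line, as the lemmas on finite measures
    demand; on each [cut n] it disappears. *)
Let Y (y : R) := a * `|y|.

Let mY : measurable_fun setT Y.
Proof. by apply: measurable_funM => //; exact: measurableT_comp. Qed.

Let Y0 y : 0 <= Y y. Proof. by rewrite mulr_ge0. Qed.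

Let mYu u : measurable_fun setT (fun y => Y y * u).
Proof. exact: measurable_funM. Qed.

Let cut_Y n y : cut n y -> Y y = a * y.
Proof. by move=> /cut_D; rewrite /= in_itv/= andbT /Y => y0; rewrite gtr0_norm. Qed.

Let massE n : fine (nuc n setT) = \int[nuc n]_y 1.
Proof. by rewrite Rintegral_cst// mul1r. Qed.

Let mcosY u : measurable_fun setT (fun y => cos (Y y * u)).
Proof.
apply: (@measurableT_comp _ _ _ _ _ _ (@cos R)) => //.
exact: continuous_measurable_fun (@continuous_cos R).
Qed.

Let msinY u : measurable_fun setT (fun y => sin (Y y * u)).
Proof.
apply: (@measurableT_comp _ _ _ _ _ _ (@sin R)) => //.
exact: continuous_measurable_fun (@continuous_sin R).
Qed.

Let mexpY : measurable_fun setT (fun y => expR (- Y y)).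
Proof. by apply: measurableT_comp => //; exact: measurableT_comp. Qed.

Let expY y : `|expR (- Y y)| <= 1.
Proof. by rewrite ger0_norm ?expR_ge0// -expR0 ler_expR oppr_le0. Qed.

Let cosE n u : \int[nuc n]_y cos (Y y * u) - fine (nuc n setT) =
  \int[nu]_(y in cut n) (cos (a * u * y) - 1).
Proof.
rewrite massE -RintegralB//; last 2 first.
- by apply: (integrable_bounded _ _ 1 (mcosY u)) => y; exact: cos_max.
- by apply: (integrable_bounded _ _ 1) => // y; rewrite normr1.
rewrite (integral_nuc _ _ (1 + 1)).
- by apply: eq_Rintegral => y /[!inE] yc; rewrite (cut_Y _ _ yc) mulrAC.
- exact: measurable_funB.
- by move=> y; apply: le_trans (ler_normB _ _) _; rewrite normr1 lerD2r cos_max.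
Qed.

Let sinE n u : \int[nuc n]_y sin (Y y * u) =
  \int[nu]_(y in cut n) sin (a * u * y).
Proof.
rewrite (integral_nuc _ _ 1) //; last by move=> y; exact: sin_max.
by apply: eq_Rintegral => y /[!inE] yc; rewrite (cut_Y _ _ yc) mulrAC.
Qed.

Let expE n : laplace_mean (nuc n) Y - fine (nuc n setT) =
  \int[nu]_(y in cut n) (expR (- (a * y)) - 1).
Proof.
rewrite massE -RintegralB//; last 2 first.
- exact: (integrable_bounded _ _ 1 mexpY).
- by apply: (integrable_bounded _ _ 1) => // y; rewrite normr1.
rewrite (integral_nuc _ _ (1 + 1)).
- by apply: eq_Rintegral => y /[!inE] yc; rewrite (cut_Y _ _ yc).
- exact: measurable_funB.
- by move=> y; apply: le_trans (ler_normB _ _) _; rewrite normr1 lerD2r.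
Qed.

Lemma cauchy_transform_subordinator :
  \int[leb]_u (k u * (expR (t * \int[nu]_(y in D) (cos (a * u * y) - 1)) *
                 cos (c * u + t * \int[nu]_(y in D) sin (a * u * y)))) =
  cauchy_mass * (expR (- c) * expR (t * \int[nu]_(y in D) (expR (- (a * y)) - 1))).
Proof.
pose f_ n u := k u * (expR (t * \int[nu]_(y in cut n) (cos (a * u * y) - 1)) *
                 cos (c * u + t * \int[nu]_(y in cut n) sin (a * u * y))).
have f_E n : \int[leb]_u f_ n u =
    cauchy_mass * (expR (- c) * expR (t * \int[nu]_(y in cut n) (expR (- (a * y)) - 1))).
  rewrite -expE -(cauchy_transform_compound_poisson (nuc n) _ mY Y0 t c c0).
  by apply: eq_Rintegral => u _; rewrite cosE sinE.
have cvexp (g : nat -> R) (l : R) : g n @[n --> \oo] --> l ->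
    expR (t * g n) @[n --> \oo] --> expR (t * l).
  move=> gl; apply: continuous_cvg; first exact: continuous_expR.
  exact: cvgMr.
have cvf u : f_ n u @[n --> \oo] --> k u * (expR (t * \int[nu]_(y in D) (cos (a * u * y) - 1)) *
                 cos (c * u + t * \int[nu]_(y in D) sin (a * u * y))).
  apply: cvgMr; apply: cvgM.
    by apply: cvexp; apply: cvg_cut; exact: integrable_cos1.
  apply: continuous_cvg; first exact: continuous_cos.
  apply: cvgD; first exact: cvg_cst.
  by apply: cvgMr; apply: cvg_cut; exact: integrable_sin.
have mf_ n : measurable_fun setT (f_ n).
  apply: measurable_funM; first exact: measurable_cauchy_kernel.
  have [m1 m2 _] := bounded_measurable_char_mean (nuc n) _ mY.
  apply: measurable_funM.
    apply: measurableT_comp => //; apply: measurable_funM => //.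
    under eq_fun do rewrite -cosE.
    exact: measurable_funB.
  apply: (@measurableT_comp _ _ _ _ _ _ (@cos R)).
    exact: continuous_measurable_fun (@continuous_cos R).
  apply: measurable_funD; first exact: measurable_funM.
  apply: measurable_funM => //.
  by under eq_fun do rewrite -sinE.
have h1 : \int[leb]_u f_ n u @[n --> \oo] -->
  \int[leb]_u (k u * (expR (t * \int[nu]_(y in D) (cos (a * u * y) - 1)) *
                 cos (c * u + t * \int[nu]_(y in D) sin (a * u * y)))).
  apply: (@cvg_Rintegral _ _ _ leb setT f_ _ k) => //.
  - by apply: (measurable_fun_cvg mf_) => u _; exact: cvf.
  - by apply: aeW => u _; exact: cvf.
  - exact: integrable_cauchy_kernel.
  (* The masses of the truncated measures may be unbounded in [n]. Domination by [k] comes instead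
     from [cos - 1 <= 0], which makes the exponent nonpositive. *)
  - move=> n u _; rewrite /f_ normrM ger0_norm ?cauchy_kernel_ge0//.
    apply: ler_piMr; first exact: cauchy_kernel_ge0.
    rewrite normrM mulr_ile1// ?cos_max// ger0_norm ?expR_ge0// -[leRHS]expR0 ler_expR.
    apply: mulr_ge0_le0 => //.
    apply: (@le_trans _ _ (\int[nu]_(y in cut n) 0)); last by rewrite Rintegral_cst// mul0r.
    apply: le_Rintegral => //.
    + exact: (integrableS mD (mcut n) (@cut_D n) (integrable_cos1 _)).
    + exact: integrable0.
have h2 : \int[leb]_u f_ n u @[n --> \oo] -->
    cauchy_mass * (expR (- c) * expR (t * \int[nu]_(y in D) (expR (- (a * y)) - 1))).
  rewrite (_ : (fun n => _) = (fun n => cauchy_mass * (expR (- c) *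
    expR (t * \int[nu]_(y in cut n) (expR (- (a * y)) - 1))))).
    apply: cvgMr; apply: cvgMr; apply: cvexp; apply: cvg_cut; exact: integrable_expR1.
  by apply/funext => n; exact: f_E.
exact: (cvg_unique _ h1 h2).
Qed.

End subordinator_exponent.

Lemma ae_eq_Rintegral {d} {T : measurableType d} {R : realType}
    (mu : {measure set T -> \bar R}) (f g : T -> R) :
  measurable_fun setT f -> measurable_fun setT g -> {ae mu, forall x, f x = g x} ->
  \int[mu]_x f x = \int[mu]_x g x.
Proof.
move=> mf mg fg; congr fine; apply: ae_eq_integral => //.
- exact/measurable_EFinP.
- exact/measurable_EFinP.
- by apply: filterS fg => x -> _.
Qed.

(** * The Laplace transform of a subordinator at a fixed time *)

Section laplace_subordinator.
Context {d} {Omega : measurableType d} {R : realType}.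
Notation leb := (@lebesgue_measure R).
Notation k := cauchy_kernel.
Local Notation D := (`]0, +oo[%classic : set R).
Variables (P : probability Omega R) (X : Omega -> R) (t gamma : R).
Variable nu : {measure set R -> \bar R}.
Hypothesis mX : measurable_fun setT X.
Hypothesis X0 : {ae P, forall w, 0 <= X w}.
Hypothesis t0 : 0 <= t.
Hypothesis nu_min : (\int[nu]_(y in D) (Num.min y 1)%:E < +oo)%E.
Hypothesis X_char_fun : forall xi : R, char_fun P X xi =
  cexp (t%:C * ((0 +i* (gamma * xi)) +
      cintegral nu D (fun y => cexp (0 +i* (xi * y)) - 1))).

Let E0 xi := expR (t * \int[nu]_(y in D) (cos (xi * y) - 1)).
Let E1 xi := t * (gamma * xi) + t * \int[nu]_(y in D) sin (xi * y).

Let XE xi : char_fun P X xi = (E0 xi * cos (E1 xi)) +i* (E0 xi * sin (E1 xi)).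
Proof.
rewrite X_char_fun /E0 /E1.
have -> : cintegral nu D (fun y => cexp (0 +i* (xi * y)) - 1) =
    (\int[nu]_(y in D) (cos (xi * y) - 1)) +i* (\int[nu]_(y in D) sin (xi * y)).
  rewrite /cintegral; congr (_ +i* _); apply: eq_Rintegral => y _.
    by rewrite cexp_imaginary.
  by rewrite cexp_imaginary /= oppr0 addr0.
by rewrite /cexp/= !mul0r subr0 addr0 add0r mulrDr.
Qed.

Let cos_char xi : \int[P]_w cos (xi * X w) = E0 xi * cos (E1 xi).
Proof. by have := XE xi; rewrite char_funE => -[]. Qed.

Let sin_char xi : \int[P]_w sin (xi * X w) = E0 xi * sin (E1 xi).
Proof. by have := XE xi; rewrite char_funE => -[]. Qed.

(* The drift [gamma] is not assumed nonnegative, so [X] is shifted by [c] to move the drift to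
   the half-line where the kernel transform is exponential. *)
Lemma laplace_subordinator (a : R) : 0 <= a ->
  \int[P]_w expR (- (a * X w)) =
  expR (- (t * (gamma * a + \int[nu]_(y in D) (1 - expR (- (a * y)))))).
Proof.
move=> a0.
pose c := Num.max 0 (- (gamma * t)); pose b := gamma * t + c.
have c0 : 0 <= c by rewrite le_max lexx.
have b0 : 0 <= b.
  have : - (gamma * t) <= c by rewrite le_max lexx orbT.
  by rewrite /b; lra.
(* [Z] is almost surely [a * (X + c)]; the maximum makes it nonnegative at every [w], so that
   [cauchy_transform] applies pointwise. *)
pose Z w := a * Num.max (X w) 0 + a * c.
have mZ : measurable_fun setT Z.
  by apply: measurable_funD => //; apply: measurable_funM => //; exact: measurable_maxr.
have Z0 w : 0 <= Z w by rewrite addr_ge0// mulr_ge0// le_max lexx orbT.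
have ZX : {ae P, forall w, Z w = a * X w + a * c}.
  by apply: filterS X0 => w Xw0; rewrite /Z max_l.
have maX : measurable_fun setT (fun w => a * X w + a * c).
  by apply: measurable_funD => //; exact: measurable_funM.
have mcosR := continuous_measurable_fun (@continuous_cos R).
have msinR := continuous_measurable_fun (@continuous_sin R).
have cosZ u : \int[P]_w cos (Z w * u) =
    E0 (a * u) * cos (a * b * u + t * \int[nu]_(y in D) sin (a * u * y)).
  rewrite (ae_eq_Rintegral _ _ (fun w =>
    cos (a * u * X w) * cos (a * c * u) - sin (a * u * X w) * sin (a * c * u))).
  - have mm : measurable_fun setT (fun w => a * u * X w) by exact: measurable_funM.
    have ic : P.-integrable setT (EFin \o (fun w => cos (a * u * X w))).
      apply: (integrable_bounded _ _ 1) => [|w]; last exact: cos_max.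
      exact: (measurableT_comp mcosR mm).
    have iS : P.-integrable setT (EFin \o (fun w => sin (a * u * X w))).
      apply: (integrable_bounded _ _ 1) => [|w]; last exact: sin_max.
      exact: (measurableT_comp msinR mm).
    rewrite RintegralB//; last 2 first.
    + by under eq_fun do rewrite /= mulrC; exact: (integrableZl_EFin _ _ _ _ _ ic).
    + by under eq_fun do rewrite /= mulrC; exact: (integrableZl_EFin _ _ _ _ _ iS).
    rewrite !RintegralZr// cos_char sin_char.
    have -> : a * b * u + t * \int[nu]_(y in D) sin (a * u * y) = E1 (a * u) + a * c * u.
      by rewrite /E1 /b; ring.
    by rewrite [in RHS]cosD; ring.
  - by apply: (measurableT_comp mcosR); exact: measurable_funM.
  - apply: measurable_funB; apply: measurable_funM => //.
      by apply: (measurableT_comp mcosR); exact: measurable_funM.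
    by apply: (measurableT_comp msinR); exact: measurable_funM.
  - apply: filterS ZX => w ->; rewrite -cosD; congr cos; ring.
have mexpZ : measurable_fun setT (fun w => expR (- Z w)).
  by apply: measurableT_comp => //; exact: measurableT_comp.
have ieZ : P.-integrable setT (EFin \o (fun w => expR (- Z w))).
  apply: (integrable_bounded _ _ 1) => // w.
  by rewrite ger0_norm ?expR_ge0// -[leRHS]expR0 ler_expR oppr_le0.
have eZ : \int[P]_w expR (- (a * X w)) = expR (a * c) * \int[P]_w expR (- Z w).
  rewrite -RintegralZl//; apply: ae_eq_Rintegral => //.
  - by apply: measurableT_comp => //; apply: measurableT_comp => //; exact: measurable_funM.
  - exact: measurable_funM.
  - by apply: filterS ZX => w ->; rewrite -expRD; congr expR; ring.
have mh : measurable_fun setT (fun p : Omega * R => cos (Z p.1 * p.2)).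
  apply: (measurableT_comp mcosR); apply: measurable_funM => //.
  exact: measurableT_comp.
(* The double integral of [k u * cos (Z w * u)] is computed twice: integrating over [w] first gives
   the exponent in [nu] with shift [a * b], integrating over [u] first gives
   [cauchy_mass * expR (- Z w)]. *)
have := cauchy_kernel_fubini P _ 1 mh (fun p => cos_max _).
under eq_Rintegral do rewrite /= cosZ.
rewrite /E0 (cauchy_transform_subordinator _ nu_min a t (a * b))//; last by rewrite mulr_ge0.
under [X in _ = X]eq_Rintegral do rewrite /= cauchy_transform//.
rewrite RintegralZl// => /(mulfI (lt0r_neq0 cauchy_mass_gt0)) E.
rewrite eZ -E -!expRD; congr expR.
have -> : \int[nu]_(y in D) (1 - expR (- (a * y))) = - \int[nu]_(y in D) (expR (- (a * y)) - 1).
  rewrite -[RHS]mulN1r -RintegralZl//; last exact: integrable_expR1.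
  by apply: eq_Rintegral => y _; rewrite mulN1r opprB.
by rewrite /b; ring.
Qed.

End laplace_subordinator.

(** * Integration against the subordinated measure *)

Section nu_sharp_integral.
Context {R : realType}.
Notation leb := (@lebesgue_measure R).
Local Notation D := (`]0, +oo[%classic : set R).
Variables (sigma : R) (nu : {measure set R -> \bar R}).
Local Notation nus := (nu_sharp sigma nu : {measure set R -> \bar R}).

Lemma measurable_heat_density2 :
  measurable_fun setT (fun p : R * R => heat_density sigma p.1 p.2).
Proof.
apply: measurable_funM.
  apply: (measurableT_comp measurable_invr).
  apply: (@measurableT_comp _ _ _ _ _ _ (@Num.sqrt R)).
    exact: continuous_measurable_fun (@sqrt_continuous R).
  exact: measurable_funM.
apply: measurableT_comp => //; apply: measurableT_comp => //.
apply: measurable_funM; first exact: measurable_funX.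
by apply: (measurableT_comp measurable_invr); exact: measurable_funM.
Qed.

Lemma measurable_heat_density t : measurable_fun setT (heat_density sigma t).
Proof.
apply: (@measurableT_comp _ _ _ _ _ _ (fun p : R * R => heat_density sigma p.1 p.2) _ (pair t)).
  exact: measurable_heat_density2.
exact: pair1_measurable.
Qed.

Let h0 t x : 0 <= heat_density sigma t x.
Proof. exact: heat_density_ge0. Qed.

Definition heat_mean (g : R -> R) (t : R) : \bar R :=
  (\int[leb]_x (g x * heat_density sigma t x)%:E)%E.

Lemma measurable_heat_mean (g : R -> R) : measurable_fun setT g ->
  (forall x, 0 <= g x) -> measurable_fun setT (heat_mean g).
Proof.
move=> mg g0.
apply: (@measurable_fun_fubini_tonelli_F _ _ _ _ _ leb
  (fun p : R * R => (g p.2 * heat_density sigma p.1 p.2)%:E)).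
  apply/measurable_EFinP; apply: measurable_funM; last exact: measurable_heat_density2.
  exact: measurableT_comp.
by move=> p; rewrite lee_fin mulr_ge0.
Qed.

Lemma heat_mean_ge0 (g : R -> R) t : (forall x, 0 <= g x) -> (0 <= heat_mean g t)%E.
Proof. by move=> g0; apply: integral_ge0 => x _; rewrite lee_fin mulr_ge0. Qed.

Let heat_mean_indic (A : set R) t : measurable A ->
  heat_mean (\1_A) t = (\int[leb]_(x in A) (heat_density sigma t x)%:E)%E.
Proof.
move=> mA; rewrite /heat_mean [RHS]integral_mkcond; apply: eq_integral => x _.
by rewrite patchE indicE; case: ifPn => _; rewrite ?mul1r ?mul0r.
Qed.

Import HBNNSimple.

Let mD : measurable D. Proof. exact: measurable_itv. Qed.

Let integral_nu_sharp_nnsfun (g : {nnsfun R >-> R}) :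
  (\int[nus]_z (g z)%:E = \int[nu]_(t in D) heat_mean g t)%E.
Proof.
pose A y : set R := g @^-1` [set y].
have mA y : measurable (A y) by exact: measurable_funPTI.
have mI y : measurable_fun setT (\1_(A y) : R -> R) by exact: measurable_indic.
(* The sums over levels are treated termwise for any real [y]; a negative level has an empty level
   set, which keeps every term nonnegative. *)
have A0 y : y < 0 -> A y = set0 by move=> y0; exact: preimage_nnfun0.
have I0 y x : 0 <= \1_(A y) x :> R by rewrite indicE.
have yI y x : 0 <= y * \1_(A y) x :> R.
  have [y0|/A0 ->] := leP 0 y; first by rewrite mulr_ge0.
  by rewrite indicE in_set0 mulr0.
have Zl y t : (\int[leb]_x (y * \1_(A y) x * heat_density sigma t x)%:E =
    y%:E * heat_mean (\1_(A y)) t)%E.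
  have [y0|/A0 ->] := leP 0 y; last first.
    rewrite heat_mean_indic// integral_set0 mule0 integral0_eq// => x _.
    by rewrite indicE in_set0 mulr0 mul0r.
  rewrite /heat_mean -ge0_integralZl//.
  - by apply: eq_integral => x _; rewrite -EFinM -mulrA.
  - by apply/measurable_EFinP; apply: measurable_funM; [exact: mI|exact: measurable_heat_density].
  - by move=> x _; rewrite lee_fin mulr_ge0.
have Z0 y t : (0 <= y%:E * heat_mean (\1_(A y)) t)%E.
  by rewrite -Zl; apply: integral_ge0 => x _; rewrite lee_fin mulr_ge0.
have E t : heat_mean g t = (\sum_(y \in range g) y%:E * heat_mean (\1_(A y)) t)%E.
  rewrite /heat_mean.
  under eq_integral => x _ do rewrite fimfunE mulr_fsuml -fsumEFin//.
  rewrite ge0_integral_fsum//.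
  - by apply: eq_fsbigr => y _; exact: Zl.
  - move=> y; apply/measurable_EFinP; apply: measurable_funM; last exact: measurable_heat_density.
    by apply: measurable_funM => //; exact: mI.
  - by move=> y x _; rewrite lee_fin mulr_ge0// yI.
under [RHS]eq_integral do rewrite E.
rewrite ge0_integral_fsum//; last first.
  move=> y; apply: emeasurable_funM => //.
  by apply: measurable_funTS; exact: measurable_heat_mean.
rewrite integralT_nnsfun sintegralE; apply: eq_fsbigr => y _.
have [y0|/A0 Ay] := leP 0 y; last first.
  rewrite -/(A y) Ay measure0 mule0 integral0_eq// => t _.
  by rewrite heat_mean_indic// integral_set0 mule0.
rewrite ge0_integralZl; last 4 first.
- exact: mD.
- by apply: measurable_funTS; exact: measurable_heat_mean.
- by move=> t _; exact: heat_mean_ge0.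
- by rewrite lee_fin.
congr (_ * _)%E; apply: eq_integral => t _.
by rewrite (heat_mean_indic _ _ (mA y)).
Qed.

(** For indicators this is the definition of [nu_sharp]. From simple functions to [g], monotone
    convergence is applied under each of the three measures. *)
Lemma integral_nu_sharp (g : R -> R) : measurable_fun setT g ->
  (forall x, 0 <= g x) ->
  (\int[nus]_z (g z)%:E = \int[nu]_(t in D) heat_mean g t)%E.
Proof.
move=> mg g0.
have meg : measurable_fun [set: R] (EFin \o g) by exact/measurable_EFinP.
pose g_ := nnsfun_approx measurableT meg.
have g_ge0 n x : 0 <= g_ n x by exact: fun_ge0.
have mg_ n : measurable_fun setT (g_ n) by exact: measurable_funPT.
have gcv x : (g_ n x)%:E @[n --> \oo] --> (g x)%:E.
  by apply: cvg_nnsfun_approx => // y _; rewrite lee_fin.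
have nd x m n : (m <= n)%N -> g_ m x <= g_ n x.
  by move=> mn; exact/lefP/nd_nnsfun_approx.
have hcv t : heat_mean g t = limn (fun n => heat_mean (g_ n) t).
  rewrite /heat_mean -monotone_convergence//.
  - apply: eq_integral => x _; apply/esym/cvg_lim => //.
    under eq_fun do rewrite EFinM.
    by rewrite EFinM; apply: cvgeMr.
  - move=> n; apply/measurable_EFinP.
    by apply: measurable_funM; [exact: mg_|exact: measurable_heat_density].
  - by move=> n x _; rewrite lee_fin mulr_ge0.
  - by move=> x _ m n mn; rewrite lee_fin ler_wpM2r// nd.
have -> : (\int[nus]_z (g z)%:E = limn (fun n => \int[nus]_z (g_ n z)%:E))%E.
  rewrite -monotone_convergence//.
  - by apply: eq_integral => x _; apply/esym/cvg_lim.
  - by move=> n; exact/measurable_EFinP.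
  - by move=> n x _; rewrite lee_fin.
  - by move=> x _ m n mn; rewrite lee_fin nd.
under eq_fun do rewrite integral_nu_sharp_nnsfun.
under [RHS]eq_integral do rewrite hcv.
rewrite monotone_convergence//.
- by move=> n; apply: measurable_funTS; exact: measurable_heat_mean.
- by move=> n t _; exact: heat_mean_ge0.
- move=> t _ m n mn; apply: ge0_le_integral => //.
  + by move=> x _; rewrite lee_fin mulr_ge0.
  + apply/measurable_EFinP; apply: measurable_funM; [exact: mg_|exact: measurable_heat_density].
  + apply/measurable_EFinP; apply: measurable_funM; [exact: mg_|exact: measurable_heat_density].
  + by move=> x _; rewrite lee_fin ler_wpM2r// nd.
Qed.

Lemma heat_mean_opp (g : R -> R) t : measurable_fun setT g ->
  (forall x, 0 <= g x) -> heat_mean (fun x => g (- x)) t = heat_mean g t.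
Proof.
move=> mg g0; rewrite /heat_mean.
pose f x := (g x * heat_density sigma t x)%:E.
have mf : measurable_fun [set: measurableTypeR R] f.
  apply/measurable_EFinP; apply: measurable_funM; [exact: mg|exact: measurable_heat_density].
have mN : measurable_fun [set: measurableTypeR R] (-%R : _ -> measurableTypeR R).
  exact: (@oppr_measurable R setT).
have f0 x : (0 <= f x)%E by rewrite lee_fin mulr_ge0.
transitivity (\int[leb]_x (f \o (-%R : R -> R)) x)%E.
  by apply: eq_integral => x _; rewrite /= /f /heat_density sqrrN.
have := ge0_integral_pushforward mN leb measurableT mf (fun x _ => f0 x).
rewrite preimage_setT => <-.
by apply: eq_measure_integral => A mA _; exact: lebesgue_measureN.
Qed.

(** By symmetry of the Gaussian density, the positive and negative parts have the same integral. No
    integrability is assumed: if this integral is infinite, the difference is infinite by convention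
    and [fine] returns 0. *)
Lemma Rintegral_nu_sharp_odd (f : R -> R) : measurable_fun setT f ->
  (forall x, f (- x) = - f x) -> \int[nus]_z f z = 0.
Proof.
move=> mf fN; rewrite /Rintegral integralE.
have pE : (EFin \o f)^\+%E = EFin \o (fun z => Num.max (f z) 0).
  by apply/funext => z; rewrite funeposE/= EFin_max.
have nE : (EFin \o f)^\-%E = EFin \o (fun z => Num.max (f (- z)) 0).
  by apply/funext => z; rewrite funenegE/= fN EFin_max.
have mp : measurable_fun setT (fun z => Num.max (f z) 0) by exact: measurable_maxr.
have p0 z : 0 <= Num.max (f z) 0 by rewrite le_max lexx orbT.
have -> : (\int[nus]_z (EFin \o f)^\-%E z = \int[nus]_z (EFin \o f)^\+%E z)%E.
  have mpN : measurable_fun setT (fun z : R => Num.max (f (- z)) 0).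
    by apply: (measurableT_comp mp); exact: (@oppr_measurable R setT).
  rewrite pE nE (integral_nu_sharp _ mpN (fun z : R => p0 (- z))) (integral_nu_sharp _ mp p0).
  by apply: eq_integral => t _; exact: (heat_mean_opp (fun z => Num.max (f z) 0)).
by case: (integral _ _ _) => [r| |]//=; rewrite subrr.
Qed.

End nu_sharp_integral.

Lemma cintegral_nu_sharp {R : realType} (sigma : R) (nu : {measure set R -> \bar R}) (xi : R) :
  0 < sigma ->
  cintegral (nu_sharp sigma nu : {measure set R -> \bar R}) [set z | z != 0]
     (fun z => 1 - cexp (0 +i* (xi * z)) +
               (0 +i* (xi * z * \1_[set u : R | `|u| <= 1] z))) =
  (\int[nu]_(t in `]0, +oo[) (1 - expR (- (sigma ^+ 2 * xi ^+ 2 / 2 * t))))%:C.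
Proof.
move=> s0; rewrite /cintegral -[RHS]complexr0.
have mcosR := continuous_measurable_fun (@continuous_cos R).
have msinR := continuous_measurable_fun (@continuous_sin R).
have mxi : measurable_fun [set: R] (fun z => xi * z) by exact: measurable_funM.
have mn0 : measurable [set z : R | z != 0].
  rewrite (_ : [set z | _] = ~` [set 0]); first exact: measurableC.
  by apply/seteqP; split => z /= /eqP.
congr (_ +i* _).
  rewrite Rintegral_mkcond.
  (* The integrand vanishes at 0, so the excluded point can be restored; the compensator is
     imaginary and drops out of the real part. *)
  transitivity (\int[nu_sharp sigma nu : {measure set R -> \bar R}]_z (1 - cos (xi * z))).
    apply: eq_Rintegral => z _; rewrite patchE; case: ifPn; rewrite ?inE/= ?notin_setE/=.
      by rewrite expR0 mul1r addr0.
    by move=> /negP; rewrite negbK => /eqP ->; rewrite mulr0 cos0 subrr.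
  rewrite /Rintegral integral_nu_sharp//; last first.
    by apply: measurable_funB => //; exact: (measurableT_comp mcosR mxi).
  congr fine; apply: eq_integral => t; rewrite inE/= in_itv/= andbT => t0.
  have ih := integrable_heat_density sigma t s0 t0.
  have ic : (@lebesgue_measure R).-integrable setT
      (EFin \o (fun z => cos (xi * z) * heat_density sigma t z)).
    apply: (@le_integrable _ _ _ (@lebesgue_measure R) _ measurableT _
      (EFin \o heat_density sigma t)).
    - apply/measurable_EFinP; apply: measurable_funM; last exact: measurable_heat_density.
      exact: (measurableT_comp mcosR mxi).
    - by move=> z _; rewrite /= lee_fin normrM ler_piMl// cos_max.
    - exact: ih.
  transitivity (\int[lebesgue_measure]_z (heat_density sigma t z)%:E -
      \int[lebesgue_measure]_z (cos (xi * z) * heat_density sigma t z)%:E)%E.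
    rewrite -integralB//; apply: eq_integral => z _.
    by rewrite mulrBl mul1r EFinB.
  have h1 := integral_heat_density sigma t s0 t0.
  have h2 := heat_density_char_fun sigma t s0 t0 xi.
  rewrite -[X in (X - _)%E]fineK; last exact: (integrable_fin_num measurableT ih).
  rewrite -[X in (_ - X)%E]fineK; last exact: (integrable_fin_num measurableT ic).
  move: h1 h2; rewrite /Rintegral => -> ->.
  by rewrite -EFinB; congr (1 - expR _)%:E; ring.
rewrite Rintegral_mkcond; apply: Rintegral_nu_sharp_odd.
  apply/(measurable_restrictT _ _).1 => //; apply: measurable_funTS.
  rewrite (_ : (fun z => _) = fun z => - sin (xi * z) + xi * z * \1_[set u : R | `|u| <= 1] z).
    apply: measurable_funD.
      by apply: measurableT_comp => //; exact: (measurableT_comp msinR mxi).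
    apply: measurable_funM => //; apply: measurable_indic.
    rewrite (_ : [set u | _] = `[-1, 1]%classic); first exact: measurable_itv.
    by apply/seteqP; split => u /=; rewrite in_itv/= ler_norml.
  by apply/funext => z; rewrite /= expR0 mul1r add0r.
move=> z; rewrite !patchE.
have -> : (- z \in [set z : R | z != 0]) = (z \in [set z : R | z != 0]).
  by apply/idP/idP; rewrite !inE/= oppr_eq0.
case: ifPn => _; last by rewrite oppr0.
have -> : \1_[set u : R | `|u| <= 1] (- z) = \1_[set u : R | `|u| <= 1] z :> R.
  by rewrite !indicE; congr (nat_of_bool _)%:R; apply/idP/idP; rewrite !inE/= normrN.
by rewrite /= expR0 !mul1r !add0r mulrN sinN mulNr opprK opprD opprK.
Qed.

(** * Independence and discretization *)

Section expectation.
Context {d} {Omega : measurableType d} {R : realType}.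
Variable P : probability Omega R.

Lemma Rintegral_sum (I : Type) (s : seq I) (F : I -> Omega -> R) :
  (forall i, P.-integrable setT (EFin \o F i)) ->
  \int[P]_w (\sum_(i <- s) F i w) = \sum_(i <- s) \int[P]_w F i w.
Proof.
move=> iF; elim: s => [|i s ih].
  under eq_Rintegral do rewrite big_nil.
  by rewrite Rintegral_cst// mul0r big_nil.
under eq_Rintegral do rewrite big_cons.
rewrite RintegralD//; first by rewrite ih big_cons.
rewrite /comp; under eq_fun do rewrite -sumEFin.
by apply: integrable_sum => // j _; exact: iF.
Qed.

Lemma Rintegral_indic (A : set Omega) : measurable A ->
  \int[P]_w \1_A w = fine (P A).
Proof. by move=> mA; rewrite /Rintegral integral_indic// setIT. Qed.

(** Restricting [P] to [A] and pushing forward by [Y] gives [P A] times the law of [Y]. The shift by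
    [M] makes the integrand nonnegative for the change of variables. *)
Lemma Rintegral_independent (A : set Omega) (Y : Omega -> R) (g : R -> R) (M : R) :
  measurable A -> measurable_fun setT Y ->
  (forall B, measurable B -> P (A `&` Y @^-1` B) = (P A * P (Y @^-1` B))%E) ->
  measurable_fun setT g -> (forall x, `|g x| <= M) ->
  \int[P]_w (\1_A w * g (Y w)) = fine (P A) * \int[P]_w g (Y w).
Proof.
move=> mA mY AY mg gM.
have PA : (P A < +oo)%E by rewrite (le_lt_trans (probability_le1 _ _))// ltry.
pose m := mfrestr mA PA.
have mgY : measurable_fun setT (fun w => g (Y w)) by exact: measurableT_comp.
have gM0 x : 0 <= g x + M by have := gM x; rewrite ler_norml => /andP[]; lra.
have mh : measurable_fun setT (fun x => (g x + M)%:E).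
  by apply/measurable_EFinP; exact: measurable_funD.
have ib (f : Omega -> R) (C : R) := integrable_bounded P f C.
have igY : P.-integrable setT (EFin \o (fun w => g (Y w))) by exact: ib mgY _.
have h : \int[P]_(w in A) (g (Y w) + M) = fine (P A) * \int[P]_w (g (Y w) + M).
  rewrite -(Rintegral_mfrestr _ _ mA PA _ (M + M)); last 2 first.
  - exact: measurable_funD.
  - move=> w; apply: le_trans (ler_normD _ _) _; apply: lerD => //.
    by rewrite ger0_norm// (le_trans _ (gM 0)).
  rewrite /Rintegral.
  have E (mu : {measure set Omega -> \bar R}) :
      (\int[mu]_w (g (Y w) + M)%:E = \int[pushforward mu Y]_x (g x + M)%:E)%E.
    apply/esym; apply: (ge0_integral_pushforward mY mu measurableT mh).
    by move=> x _; rewrite lee_fin.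
  rewrite !E.
  pose m2 := mscale (NngNum (fine_ge0 (measure_ge0 P A))) (pushforward P Y).
  transitivity (fine (\int[m2 mY]_x (g x + M)%:E)%E).
    congr fine; apply: eq_measure_integral => //= B mB _.
    transitivity (P (Y @^-1` B `&` A)) => //.
    rewrite setIC AY// /mscale/= fineK// ge0_fin_numE//.
  rewrite ge0_integral_mscale//; last by move=> x _; rewrite lee_fin.
  rewrite fineM//= -E; apply: integrable_fin_num => //.
  exact: (integrableD_EFin _ _ _ _ _ igY (ib _ `|M| _ _)).
have iA : P.-integrable setT (EFin \o (\1_A : Omega -> R)) by exact: integrable_indic.
have mI : measurable_fun setT (\1_A : Omega -> R) by exact: measurable_indic.
have I1 w : `|\1_A w| <= 1 :> R.
  by rewrite indicE; case: (_ \in _); rewrite ?normr1 ?normr0.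
have -> : \int[P]_w (\1_A w * g (Y w)) = \int[P]_(w in A) (g (Y w) + M) - M * fine (P A).
  have -> : \int[P]_(w in A) (g (Y w) + M) = \int[P]_w (\1_A w * g (Y w) + M * \1_A w).
    rewrite Rintegral_mkcond; apply: eq_Rintegral => w _; rewrite patchE indicE.
    by case: (w \in A) ; rewrite ?mul1r ?mulr1 ?mul0r ?mulr0 ?addr0.
  rewrite RintegralD//.
  - by rewrite RintegralZl// Rintegral_indic// addrK.
  - apply: (ib _ M); first exact: measurable_funM.
    by move=> w; rewrite normrM -[leRHS]mul1r ler_pM.
  - exact: (integrableZl_EFin _ _ _ _ _ iA).
rewrite h RintegralD//; last by exact: (ib _ `|M|).
have PT : fine (P [set: Omega]) = 1 by rewrite probability_setT.
by rewrite Rintegral_cst// [fine (_ setT)]PT mulr1; ring.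
Qed.

End expectation.

Section grid.
Context {R : realType}.

(* The floor of [n.+1 * y], capped so that it takes finitely many values. *)
Definition grid_index (n : nat) (y : R) : 'I_(n.+1 * n.+1).+1 :=
  inord (minn (n.+1 * n.+1) (Num.truncn (n.+1%:R * y))).

Definition grid_value (n : nat) (j : 'I_(n.+1 * n.+1).+1) : R := j%:R / n.+1%:R.

Lemma grid_value_ge0 n j : 0 <= @grid_value n j.
Proof. by rewrite /grid_value divr_ge0. Qed.

Lemma grid_indexE n y :
  grid_index n y = minn (n.+1 * n.+1) (Num.truncn (n.+1%:R * y)) :> nat.
Proof. by rewrite inordK// ltnS geq_minl. Qed.

Lemma measurable_grid_index n j : measurable [set y | grid_index n y = j].
Proof.
have mle i : measurable [set y : R | (grid_index n y <= i)%N].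
  have [ni|ni] := leqP (n.+1 * n.+1) i.
    rewrite (_ : [set y | _] = setT)//; apply/seteqP; split => y //= _.
    by rewrite grid_indexE geq_min ni.
  rewrite (_ : [set y | _] = `]-oo, i.+1%:R / n.+1%:R[%classic); first exact: measurable_itv.
  apply/seteqP; split => y /=; rewrite grid_indexE geq_min leqNgt ni/= truncn_le_nat in_itv/=.
    by rewrite ltr_pdivlMr ?ltr0n// mulrC.
  by rewrite ltr_pdivlMr ?ltr0n// mulrC.
case E : (j : nat) => [|i].
  rewrite (_ : [set y | _] = [set y | (grid_index n y <= 0)%N]); first exact: mle.
  apply/seteqP; split => y /=; first by move=> ->; rewrite E.
  by rewrite leqn0 => /eqP h; apply: val_inj; rewrite /= h E.
rewrite (_ : [set y | _] =
    [set y | (grid_index n y <= i.+1)%N] `\` [set y | (grid_index n y <= i)%N]).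
  by apply: measurableD; exact: mle.
apply/seteqP; split => y /=.
  by move=> ->; rewrite E leqnn ltnn.
move=> [h1 /negP h2]; apply: val_inj => /=; rewrite E; apply/eqP.
by rewrite eqn_leq h1 ltnNge.
Qed.

Lemma measurable_grid_value n :
  measurable_fun setT (fun y => grid_value n (grid_index n y)).
Proof.
rewrite (_ : (fun y => _) = fun y => \sum_j (grid_value n j * \1_[set y | grid_index n y = j] y)).
  apply: measurable_sum => j; apply: measurable_funM => //.
  by apply: measurable_indic; exact: measurable_grid_index.
apply/funext => y; rewrite (bigD1 (grid_index n y))//= big1 ?addr0.
  by rewrite indicE mem_set ?mulr1.
by move=> j /eqP jy; rewrite indicE memNset ?mulr0//= => /esym.
Qed.

(** The cap on the index corresponds to the value [n.+1], so it is inactive once [n >= y]; rounding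
    down then loses at most [1 / n.+1]. *)
Lemma cvg_grid (y : R) : 0 <= y ->
  grid_value n (grid_index n y) @[n --> \oo] --> y.
Proof.
move=> y0.
apply: (@squeeze_cvgr _ _ _ _ (fun n => y - harmonic n) (cst y)); last 2 first.
- by rewrite -[X in _ --> X](subr0 y); apply: cvgB; [exact: cvg_cst|exact: cvg_harmonic].
- exact: cvg_cst.
near=> n.
have yn : y <= n.+1%:R.
  apply: (@le_trans _ _ n%:R); last by rewrite ler_nat.
  by near: n; exact: nbhs_infty_ger.
have n0 : 0 < n.+1%:R :> R by rewrite ltr0n.
have ny0 : 0 <= n.+1%:R * y by rewrite mulr_ge0.
have /andP[t1 t2] := truncn_itv ny0.
have tn : (Num.truncn (n.+1%:R * y) <= n.+1 * n.+1)%N.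
  by rewrite -(ler_nat R) natrM (le_trans t1)// ler_wpM2l.
rewrite /grid_value grid_indexE (minn_idPr tn) /harmonic/=.
apply/andP; split; last by rewrite ler_pdivrMr// [_ * n.+1%:R]mulrC.
rewrite lerBlDr -[X in _ + X]mul1r -mulrDl ler_pdivlMr// [_ * n.+1%:R]mulrC natr1.
exact: ltW.
Unshelve. all: by end_near. Qed.

End grid.

Lemma cvg_row {R : realType} n (u : nat -> 'I_n -> R) (v : 'I_n -> R) :
  (forall k, u i k @[i --> \oo] --> v k) ->
  (\row_k u i k : 'rV[R]_n) @[i --> \oo] --> (\row_k v k : 'rV[R]_n).
Proof.
move=> uv A [B vB BA].
have h : \forall i \near \oo, forall p : 'I_1 * 'I_n, B p.1 p.2 (u i p.2).
  apply: filter_forall => -[i j]; apply: uv.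
  by have := vB i j; rewrite mxE.
by apply: filterS h => i hi; apply: BA => a b; rewrite mxE; exact: (hi (a, b)).
Qed.

(** On the exceptional null set [f] is arbitrary, and completeness makes its preimages there
    measurable. This yields the measurability of the field at a random point. *)
Lemma measurable_fun_ae_cvg {d} {T : measurableType d} {R : realType}
    (mu : {measure set T -> \bar R}) (f_ : nat -> T -> R) (f : T -> R) :
  measure_is_complete mu -> (forall n, measurable_fun setT (f_ n)) ->
  {ae mu, forall x, f_ n x @[n --> \oo] --> f x} -> measurable_fun setT f.
Proof.
move=> mu_complete mf_ [N [mN N0 fN]].
have mNC : measurable (~` N) by exact: measurableC.
have mfNC : measurable_fun (~` N) f.
  apply: (@measurable_fun_cvg _ _ _ (~` N) f_) => [n|x Nx].
    exact: measurable_funTS.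
  by apply: contrapT => h; apply: Nx; apply: fN.
move=> _ B mB; rewrite setTI -[f @^-1` B]setIT -(setUv N) setIUr.
apply: measurableU; last by rewrite setIC; exact: mfNC.
by apply: mu_complete; exists N; split => //; exact: subIsetr.
Qed.

Lemma cvg_prod_seq {R : realType} (I : Type) (s : seq I) (u : nat -> I -> R) (v : I -> R) :
  (forall i, u n i @[n --> \oo] --> v i) ->
  \prod_(i <- s) u n i @[n --> \oo] --> \prod_(i <- s) v i.
Proof.
move=> uv; elim: s => [|i s ih].
  by rewrite big_nil; under eq_fun do rewrite big_nil; exact: cvg_cst.
by rewrite big_cons; under eq_fun do rewrite big_cons; apply: cvgM.
Qed.

(** * The mean of a function of the field at an independent random point *)

Section subordination.
Context {d} {Omega : measurableType d} {R : realType}.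
Variables (P : probability Omega R) (n : nat).
Variables (W : 'rV[R]_n -> Omega -> R) (X : 'I_n -> Omega -> R).
Hypothesis mX : forall k, measurable_fun setT (X k).
Hypothesis X0 : forall k, {ae P, forall w, 0 <= X k w}.
Hypothesis X_indep : forall B : 'I_n -> set R, (forall k, measurable (B k)) ->
  P (\bigcap_k (X k @^-1` B k)) = (\prod_k P (X k @^-1` B k))%E.
Hypothesis XW_indep : forall B : 'I_n -> set R, (forall k, measurable (B k)) ->
  forall q, orthant q -> forall C, measurable C ->
  P ((\bigcap_k (X k @^-1` B k)) `&` (W q @^-1` C)) =
  (P (\bigcap_k (X k @^-1` B k)) * P (W q @^-1` C))%E.
Hypothesis mW : forall q, orthant q -> measurable_fun setT (W q).
Hypothesis cW : continuous_field P W.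

Hypothesis P_complete : measure_is_complete P.

Let L w := W (\row_k X k w) w.

(** Used with [cos (xi * _)] and [C = 1], then with [sin (xi * _)] and [C = 0], so that one argument
    serves both parts of the characteristic function. *)
Variables (g : R -> R) (a C : R).
Hypothesis (cg : continuous g) (g1 : forall x, `|g x| <= 1) (a0 : 0 <= a).
Hypothesis g_mean : forall q, orthant q ->
  \int[P]_w g (W q w) = C * \prod_k expR (- (a * q 0 k)).

Section discretized.
Variable m : nat.
Let idx := {ffun 'I_n -> 'I_(m.+1 * m.+1).+1}.
Let B j : set R := [set y | grid_index m y = j].
Let mB j : measurable (B j). Proof. exact: measurable_grid_index. Qed.
Let cell (q : idx) : set Omega := \bigcap_k (X k @^-1` B (q k)).
Let node (q : idx) : 'rV[R]_n := \row_k grid_value m (q k).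

Let node_ge0 q : orthant (node q).
Proof. by move=> k; rewrite mxE grid_value_ge0. Qed.

Let mXB k j : measurable (X k @^-1` B j).
Proof. by rewrite -[_ @^-1` _]setTI; exact: mX. Qed.

Let mcell q : measurable (cell q).
Proof. by apply: fin_bigcap_measurable => // k _; exact: mXB. Qed.

Let mg : measurable_fun setT g.
Proof. exact: continuous_measurable_fun. Qed.

Let discretize w := g (W (\row_k grid_value m (grid_index m (X k w))) w).

Let discretizeE w : discretize w = \sum_(q : idx) (\1_(cell q) w * g (W (node q) w)).
Proof.
pose q0 : idx := [ffun k => grid_index m (X k w)].
rewrite (bigD1 q0)//= big1 ?addr0.
  rewrite indicE mem_set ?mul1r; last by move=> k _ /=; rewrite /B/= ffunE.
  by rewrite /discretize /node; congr (g (W _ w)); apply/rowP => k; rewrite !mxE ffunE.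
move=> q qq0; rewrite indicE memNset ?mul0r// => qw.
move/eqP: qq0; apply; apply/ffunP => k; rewrite ffunE.
by have := qw k I.
Qed.

Let mgW q : measurable_fun setT (fun w => g (W (node q) w)).
Proof. by apply: (measurableT_comp mg); exact: mW. Qed.

Let mterm q : measurable_fun setT (fun w => \1_(cell q) w * g (W (node q) w)).
Proof. by apply: measurable_funM; [exact: measurable_indic|exact: mgW]. Qed.

Lemma measurable_discretize : measurable_fun setT discretize.
Proof.
rewrite (_ : discretize = fun w => \sum_(q : idx) (\1_(cell q) w * g (W (node q) w))).
  exact: measurable_sum.
by apply/funext => w; exact: discretizeE.
Qed.

Let p k j := fine (P (X k @^-1` B j)).

Let fine_cell q : fine (P (cell q)) = \prod_k p k (q k).
Proof.
rewrite /cell X_indep//.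
have -> : (\prod_k P (X k @^-1` B (q k)) = (\prod_k p k (q k))%:E)%E.
  elim/big_rec2 : _ => // k _ y _ ->.
  by rewrite EFinM /p fineK//; exact: fin_num_measure.
by [].
Qed.

Let indic1 (A : set Omega) w : `|\1_A w| <= 1 :> R.
Proof. by rewrite indicE; case: (_ \in _); rewrite ?normr1 ?normr0. Qed.

Let integral_grid k : \int[P]_w expR (- (a * grid_value m (grid_index m (X k w)))) =
  \sum_j p k j * expR (- (a * grid_value m j)).
Proof.
transitivity (\int[P]_w \sum_(j <- index_enum 'I_(m.+1 * m.+1).+1)
    (expR (- (a * grid_value m j)) * \1_(X k @^-1` B j) w)).
  apply: eq_Rintegral => w _; rewrite (bigD1 (grid_index m (X k w)))//= big1 ?addr0.
    by rewrite indicE mem_set ?mulr1.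
  by move=> j /eqP jw; rewrite indicE memNset ?mulr0// /B/= => /esym.
have iI j : P.-integrable setT (EFin \o (\1_(X k @^-1` B j) : Omega -> R)).
  exact: integrable_indic.
rewrite Rintegral_sum; last by move=> j; exact: (integrableZl_EFin _ _ _ _ _ (iI j)).
by apply: eq_bigr => j _; rewrite RintegralZl// Rintegral_indic// mulrC.
Qed.

(** On a cell the field sits at a fixed node, so the cell is independent of the value in question.
    The weight of the node is a product over coordinates, so the sum over all nodes factors into
    sums over one coordinate each. *)
Lemma integral_discretize : \int[P]_w discretize w =
  C * \prod_k \int[P]_w expR (- (a * grid_value m (grid_index m (X k w)))).
Proof.
under eq_Rintegral do rewrite discretizeE.
rewrite Rintegral_sum; last first.
  move=> q; apply: (@integrable_bounded _ _ _ _ _ 1); first exact: mterm.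
  by move=> w; rewrite normrM mulr_ile1.
transitivity (\sum_(q : idx) C * \prod_k (p k (q k) * expR (- (a * grid_value m (q k))))).
  apply: eq_bigr => q _.
  rewrite (Rintegral_independent _ _ _ _ 1)//; last 2 first.
  - exact: mW.
  - by move=> D mD; apply: XW_indep.
  rewrite g_mean// fine_cell mulrCA -big_split/=; congr (_ * _).
  by apply: eq_bigr => k _; rewrite mxE.
rewrite -big_distrr/= -(bigA_distr_bigA (fun k j => p k j * expR (- (a * grid_value m j)))).
by congr (_ * _); apply: eq_bigr => k _; rewrite integral_grid.
Qed.

End discretized.

Let allX0 : {ae P, forall w, forall k, 0 <= X k w}.
Proof. exact: filter_forall. Qed.

Lemma Rintegral_subordinated :
  \int[P]_w g (W (\row_k X k w) w) = C * \prod_k \int[P]_w expR (- (a * X k w)).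
Proof.
pose g_ m w := g (W (\row_k grid_value m (grid_index m (X k w))) w).
have cvg_g : {ae P, forall w, g_ m w @[m --> \oo] --> g (L w)}.
  apply: filterS2 allX0 cW => w Xw cWw.
  apply: continuous_cvg; first exact: cg.
  move/subspace_continuousP : cWw => /(_ (\row_k X k w)) cWw A Ax.
  have ox : orthant (\row_k X k w) by move=> k; rewrite mxE.
  have /= := @cvg_row R n (fun m k => grid_value m (grid_index m (X k w))) (fun k => X k w).
  move=> /(_ (fun k => cvg_grid _ (Xw k))) xcv.
  pose r m : 'rV[R]_n := \row_k grid_value m (grid_index m (X k w)).
  (* Paths are continuous only within the orthant; the approximating points stay there because grid
     values are nonnegative. *)
  have near_r : \forall m \near \oo, orthant (r m) -> A (W (r m) w).
    exact: (xcv _ (cWw ox _ Ax)).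
  have : \forall m \near \oo, A (W (r m) w).
    by apply: filterS near_r => m; apply => k; rewrite mxE; exact: grid_value_ge0.
  exact.
have h1 : \int[P]_w g_ m w @[m --> \oo] --> \int[P]_w g (L w).
  apply: (@cvg_Rintegral _ _ _ P setT g_ _ (fun=> 1)) => //.
  - by move=> m; exact: measurable_discretize.
  - exact: (measurable_fun_ae_cvg _ _ _ P_complete measurable_discretize cvg_g).
  - by apply: filterS cvg_g.
  - by apply: (@integrable_bounded _ _ _ _ _ 1) => // w; rewrite normr1.
  - by move=> m w _; exact: g1.
have h2 : \int[P]_w g_ m w @[m --> \oo] --> C * \prod_k \int[P]_w expR (- (a * X k w)).
  rewrite (_ : (fun m => _) = fun m => C *
    \prod_k \int[P]_w expR (- (a * grid_value m (grid_index m (X k w))))); last first.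
    by apply/funext => m; exact: integral_discretize.
  apply: cvgMr; apply: cvg_prod_seq => k.
  have me : measurable_fun setT (fun y : R => expR (- (a * y))).
    by apply: measurableT_comp => //; apply: measurableT_comp => //; exact: measurable_funM.
  apply: (@cvg_Rintegral _ _ _ P setT _ _ (fun=> 1)) => //.
  - move=> m; apply: (measurableT_comp me).
    exact: (measurableT_comp (measurable_grid_value m) (mX k)).
  - exact: (measurableT_comp me (mX k)).
  - apply: filterS (X0 k) => w Xw _.
    apply: continuous_cvg; first exact: continuous_expR.
    apply: cvgN; apply: cvgMr; exact: cvg_grid.
  - by apply: (@integrable_bounded _ _ _ _ _ 1) => // w; rewrite normr1.
  - move=> m w _; rewrite ger0_norm ?expR_ge0// -[leRHS]expR0 ler_expR oppr_le0.
    by rewrite mulr_ge0// grid_value_ge0.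
exact: (cvg_unique _ h1 h2).
Qed.

End subordination.

(** * The characteristic function of the subordinated field *)

Lemma cexp_real {R : realType} (r : R) : cexp r%:C = (expR r)%:C.
Proof. by rewrite cexpE /= /cis cos0 sin0 mulr1. Qed.

Theorem theorem4p6 (disp : measure_display) (Omega : measurableType disp)
    (R : realType) (P : probability Omega R)
    (P_complete : measure_is_complete P)
    (d : nat) (d_ge2 : (2 <= d)%N)
    (T : 'I_d -> R) (T_gt0 : forall k, 0 < T k)
    (W : 'rV[R]_d -> Omega -> R) (sigma : R)
    (W_gaussian : gaussian_field P W)
    (W_zero_mean : zero_mean P W)
    (W_continuous : continuous_field P W)
    (W_measurable : jointly_measurable W)
    (sigma_gt0 : 0 < sigma)
    (W_char_fun : forall (x : 'rV[R]_d) (xi : R), orthant x ->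
       char_fun P (W x) xi =
       (expR (- (2^-1 * sigma ^+ 2 * xi ^+ 2 * \sum_(k < d) x 0 k)))%:C)
    (l : 'I_d -> R -> Omega -> R)
    (gamma : 'I_d -> R) (nu : 'I_d -> {measure set R -> \bar R})
    (l_subordinator : forall k, levy_subordinator P (T k) (l k))
    (l_triplet : forall k, subordinator_triplet P (T k) (l k) (gamma k) (nu k))
    (l_independent : mutually_independent P
       (fun k => sigma_process `[0, T k] (l k)))
    (l_independent_W : independent P
       <<s \bigcup_k sigma_process `[0, T k] (l k) >>
       (sigma_process (@orthant R d) W))
    (x : 'rV[R]_d) (xi : R) (x_in_box : forall k, 0 <= x 0 k <= T k) :
  let L := subordinated_field W l in
  let nu_ext := fun k : 'I_d =>
    (nu_sharp sigma (nu k) : {measure set R -> \bar R}) in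
  char_fun P (L x) xi =
  cexp (- \sum_(k < d) (x 0 k)%:C *
    ((sigma ^+ 2 * xi ^+ 2 / 2 * gamma k)%:C +
     cintegral (nu_ext k) [set z | z != 0]
       (fun z => 1 - cexp (0 +i* (xi * z)) +
                 (0 +i* (xi * z * \1_[set u : R | `|u| <= 1] z))))).
Proof.
move=> L nu_ext.
pose a := sigma ^+ 2 * xi ^+ 2 / 2.
have a0 : 0 <= a by rewrite divr_ge0// mulr_ge0// sqr_ge0.
have x0 k : 0 <= x 0 k by have /andP[] := x_in_box k.
have xT k : x 0 k \in `[0, T k] by rewrite in_itv/= x_in_box.
pose X k := l k (x 0 k).
have mX k : measurable_fun setT (X k).
  by have [[ml _ _ _ _] _] := l_subordinator k; exact: ml.
have X0 k : {ae P, forall w, 0 <= X k w}.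
  have [[_ l0 _ _ _] mono] := l_subordinator k.
  apply: filterS2 l0 mono => w l0w h.
  rewrite -[leLHS]l0w; apply: h => //.
  by have /andP[] := x_in_box k.
have genX k B : measurable B -> sigma_process `[0, T k] (l k) (X k @^-1` B).
  move=> mB; apply: sub_sigma_algebra; exists (x 0 k); first exact: xT.
  by exists B.
have genW q B : orthant q -> measurable B -> sigma_process (@orthant R d) W (W q @^-1` B).
  by move=> oq mB; apply: sub_sigma_algebra; exists q => //; exists B.
have X_indep (B : 'I_d -> set R) : (forall k, measurable (B k)) ->
    P (\bigcap_k (X k @^-1` B k)) = (\prod_k P (X k @^-1` B k))%E.
  move=> mB; have := l_independent [set: 'I_d]%SET (fun k => X k @^-1` B k).
  move=> /(_ (fun k _ => genX k _ (mB k))).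
  rewrite (_ : [set` [set: 'I_d]%SET] = [set: 'I_d]); last first.
    by apply/seteqP; split => k //= _; rewrite finset.in_setT.
  by move=> ->; apply: eq_bigl => k; rewrite finset.in_setT.
have XW_indep (B : 'I_d -> set R) : (forall k, measurable (B k)) ->
    forall q, orthant q -> forall C, measurable C ->
    P ((\bigcap_k (X k @^-1` B k)) `&` (W q @^-1` C)) =
    (P (\bigcap_k (X k @^-1` B k)) * P (W q @^-1` C))%E.
  move=> mB q oq C mC; apply: l_independent_W; last exact: genW.
  pose S := \bigcup_k sigma_process `[0, T k] (l k).
  (* Taking the sigma-algebra generated by [S] as the measurable structure makes the joint event of
     all the [X k] one of its members. *)
  apply: (@fin_bigcap_measurable _ (g_sigma_algebraType S)) => // k _.
  by apply: sub_sigma_algebra; exists k => //; exact: genX.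
have mW q : orthant q -> measurable_fun setT (W q).
  by move=> oq; have [mWq _] := W_gaussian 1 (fun=> q) (fun=> oq); exact: (mWq ord0).
have W_mean q : orthant q ->
    \int[P]_w cos (xi * W q w) = 1 * \prod_k expR (- (a * q 0 k)) /\
    \int[P]_w sin (xi * W q w) = 0 * \prod_k expR (- (a * q 0 k)).
  move=> oq; have := W_char_fun q xi oq; rewrite char_funE => -[-> ->].
  rewrite mul0r mul1r -expR_sum; split => //; congr expR.
  by rewrite -mulNr mulr_sumr; apply: eq_bigr => k _; rewrite /a; field.
have laplaceX k : \int[P]_w expR (- (a * X k w)) =
    expR (- (x 0 k * (gamma k * a + \int[nu k]_(y in `]0, +oo[) (1 - expR (- (a * y)))))).
  have [[_ _ nu_min] hchar] := l_triplet k.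
  apply: laplace_subordinator => //.
  by move=> u; apply: hchar.
have cxi : continuous (fun y : R => xi * y) by move=> y; exact: mulrl_continuous.
have LE w : L x w = W (\row_k X k w) w by [].
have cosL : \int[P]_w cos (xi * L x w) = \prod_k \int[P]_w expR (- (a * X k w)).
  rewrite -[RHS]mul1r.
  apply: (Rintegral_subordinated _ _ _ _ mX X0 X_indep XW_indep mW W_continuous P_complete
    (fun y => cos (xi * y)) a 1) => //.
  - by move=> y; apply: (continuous_comp (cxi y)); exact: continuous_cos.
  - by move=> y; exact: cos_max.
  - by move=> q /W_mean[].
have sinL : \int[P]_w sin (xi * L x w) = 0.
  rewrite -[RHS](mul0r (\prod_k \int[P]_w expR (- (a * X k w)))).
  apply: (Rintegral_subordinated _ _ _ _ mX X0 X_indep XW_indep mW W_continuous P_complete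
    (fun y => sin (xi * y)) a 0) => //.
  - by move=> y; apply: (continuous_comp (cxi y)); exact: continuous_sin.
  - by move=> y; exact: sin_max.
  - by move=> q /W_mean[].
have -> : char_fun P (L x) xi = (\prod_k \int[P]_w expR (- (a * X k w)))%:C.
  by rewrite char_funE cosL sinL complexr0.
under eq_bigr do rewrite laplaceX.
rewrite -expR_sum -cexp_real; congr cexp.
rewrite rmorph_sum/= -sumrN; apply: eq_bigr => k _.
rewrite /nu_ext cintegral_nu_sharp// -rmorphD -rmorphM -rmorphN/= -/a.
by rewrite [gamma k * a]mulrC.
Qed.
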